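(* Let $U$ be a $\mathbf{B}_r$-module and $V$ a $\mathbf{B}_1$-module with $V(\emptyset)=\{0\}$. Then $\mathrm{ch}(U\circ V)=\mathrm{ch}(U)\circ\mathrm{ch}(V)$ in $\mathbb{A}(r)$.
   Context: $\mu_r$, $W(r,n)=\mu_r\wr S_n$, $\mathbf{B}_r$ = category of finite sets with free $\mu_r$-action and equivariant bijections ($\mathbf{B}_1$ = finite sets and bijections), $[n]_r=\mu_r\times\{1,\dots,n\}$. A $\mathbf{B}_r$-module is a functor from $\mathbf{B}_r$ to finite-dimensional complex vector spaces, with characteristic $\mathrm{ch}(U)=\sum_n\frac{1}{r^nn!}\sum_{w\in W(r,n)}\mathrm{tr}(w,U([n]_r))p_w\in\mathbb{A}(r)=\mathbb{C}[[p_i(\zeta):i\ge1,\zeta\in\mu_r]]$, where $p_w=\prod p_i(\zeta)^{a_i(\zeta)}$, $a_i(\zeta)$ the number of cycles of $w$ of length $i$ and type $\zeta$ (product of the $\mu_r$-entries along the cycle); for $r=1$, $p_i=p_i(1)$. Substitution: $(U\circ V)(I)=\bigoplus_{\pi}\bigl(U(\pi)\otimes\bigotimes_{\mathcal{O}\in\mu_r\backslash\pi}V(\mathcal{O})\bigr)$ over partitions $\pi$ of $I$ into nonempty blocks permuted by $\mu_r$ with $\mu_r$ acting freely on the blocks; $V(\mathcal{O})=\{(v_J)\in\prod_{J\in\mathcal{O}}V(J): v_{\zeta J}=V(\zeta)(v_J)\}$. Plethysm $\circ:\mathbb{A}(r)\times\mathbb{A}(1)_+\to\mathbb{A}(r)$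 is the unique operation such that $f\mapsto f\circ g$ is a continuous algebra homomorphism, $g\mapsto p_i(\zeta)\circ g$ is a continuous algebra homomorphism, and $p_i(\zeta)\circ p_j=p_{ij}(\zeta^j)$. *)

(* Defs.v *)
From HB Require Import structures.
From mathcomp Require Import all_boot all_order all_algebra all_fingroup.
Set Implicit Arguments. Unset Strict Implicit. Unset Printing Implicit Defensive.
Import GRing.Theory Num.Theory.
Local Open Scope ring_scope.

(** * mu_r, encoded additively: for r >= 1, mu r = Z/r (k <-> exp(2 i pi k / r)). *)
Notation mu r := ('I_(r.-1).+1).

Definition is_free_act (r : nat) (T : finType) (a : mu r -> T -> T) : Prop :=
  [/\ forall x, a 0 x = x,
      forall g h x, a (g + h) x = a g (a h x)
    & forall g x, a g x = x -> g = 0].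

Definition is_mor (r : nat) (T T' : finType) (a : mu r -> T -> T)
    (a' : mu r -> T' -> T') (f : T -> T') : Prop :=
  bijective f /\ forall g x, f (a g x) = a' g (f x).

(** * B_r-modules: functors B_r -> finite-dimensional C-vector spaces.
   The space attached to an object is C^(bas T a) (coordinates in a finite
   basis), and a morphism f acts by the matrix mat f, in the convention
   e_b |-> sum_b' mat f b b' e_b'.  The data is given on all "pre-objects"
   (T, a) and all functions; the functor laws are only required on genuine
   objects and morphisms of B_r. *)
Record Bmod (C : numClosedFieldType) (r : nat) := {
  bas : forall T : finType, (mu r -> T -> T) -> finType;
  mat : forall (T T' : finType) (a : mu r -> T -> T) (a' : mu r -> T' -> T'),
      (T -> T') -> @bas T a -> @bas T' a' -> C;
  mat_id : forall (T : finType) (a : mu r -> T -> T), is_free_act a ->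
      forall b b', @mat T T a a (fun x => x) b b' = (b == b')%:R;
  mat_comp : forall (T1 T2 T3 : finType) (a1 : mu r -> T1 -> T1)
      (a2 : mu r -> T2 -> T2) (a3 : mu r -> T3 -> T3) (f : T1 -> T2) (g : T2 -> T3),
      is_free_act a1 -> is_free_act a2 -> is_free_act a3 ->
      is_mor a1 a2 f -> is_mor a2 a3 g ->
      forall b1 b3, @mat T1 T3 a1 a3 (g \o f) b1 b3 =
        \sum_(b2 : @bas T2 a2) @mat T1 T2 a1 a2 f b1 b2 * @mat T2 T3 a2 a3 g b2 b3
}.

Definition triv (T : finType) : mu 1 -> T -> T := fun _ x => x.

(** * The ring A(r).
   A monomial of degree (weight) n is prod p_{k+1}(z)^(m (k,z)), k < n, z in mu_r;
   an element of A(r) is given by its coefficients on monomials of each weight n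
   (values on monomials m : mono r n with weight m <> n are irrelevant). *)
Definition mono (r n : nat) := {ffun 'I_n * mu r -> 'I_n.+1}.

Definition weight r n (m : mono r n) : nat :=
  (\sum_(kz : 'I_n * mu r) kz.1.+1 * m kz)%N.

Definition ser (C : numClosedFieldType) (r : nat) := forall n : nat, mono r n -> C.

Definition ext r n (m : mono r n) (j : nat) (z : mu r) : nat :=
  if (insub j : option 'I_n) is Some j' then nat_of_ord (m (j', z)) else 0%N.

Definition smul C r (f g : ser C r) : ser C r := fun n m =>
  \sum_(k < n.+1) \sum_(m1 : mono r k) \sum_(m2 : mono r (n - k))
    ((weight m1 == k) && (weight m2 == n - k)%N &&
      [forall kz : 'I_n * mu r,
         ext m kz.1 kz.2 == (ext m1 kz.1 kz.2 + ext m2 kz.1 kz.2)%N])%:R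
    * (f k m1 * g (n - k)%N m2).

Definition sone C r : ser C r := fun n _ => (n == 0)%N%:R.

Definition spow C r (f : ser C r) (e : nat) : ser C r := iter e (smul f) (@sone C r).

(** exponent of p_{j+1}(z') in the image of the A(1)-monomial b under
    p_j' |-> p_{i j'}(z^j') *)
Definition dil r n (i : nat) (z : mu r) (b : mono 1 n) (j : nat) (z' : mu r) : nat :=
  if (i %| j.+1)%N then
    (if z' == z *+ (j.+1 %/ i) then ext b (j.+1 %/ i).-1 (0 : mu 1) else 0%N)
  else 0%N.

Definition pvar C r (i : nat) (z : mu r) (g : ser C 1) : ser C r := fun n M =>
  if (i %| n)%N then
    \sum_(b : mono 1 (n %/ i))
      ((weight b == n %/ i)%N &&
        [forall kz : 'I_n * mu r, ext M kz.1 kz.2 == dil i z b kz.1 kz.2])%:R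
      * g (n %/ i)%N b
  else 0.

(** f o g = sum_m f_m prod_{(i,z)} (p_i(z) o g)^(m_(i,z)).  Since g has no
    constant term, p_i(z) o g has no terms of degree < i, so only monomials
    m of weight <= n contribute to the degree-n part. *)
Definition pleth C r (f : ser C r) (g : ser C 1) : ser C r := fun n M =>
  \sum_(k < n.+1) \sum_(m : mono r k)
     (weight m == k)%:R * f k m *
     (\big[@smul C r / @sone C r]_(kz : 'I_k * mu r)
         spow (pvar kz.1.+1 kz.2 g) (m kz)) n M.

Definition nact r n (g : mu r) (x : mu r * 'I_n) : mu r * 'I_n := (g + x.1, x.2).

(** the element w = (c; s) of W(r,n) = Aut([n]_r): (z, i) |-> (z + c i, s i) *)
Definition wfun r n (c : {ffun 'I_n -> mu r}) (s : 'S_n) (x : mu r * 'I_n) : mu r * 'I_n :=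
  (x.1 + c x.2, s x.2).

Definition ctype r n (c : {ffun 'I_n -> mu r}) (s : 'S_n) : mono r n :=
  [ffun kz : 'I_n * mu r => inord #|[set O in porbits s |
        (#|O| == kz.1.+1) && (\sum_(i in O) c i == kz.2)]|].

Definition chc (C : numClosedFieldType) r (B : forall T : finType, (mu r -> T -> T) -> finType)
    (M : forall (T T' : finType) (a : mu r -> T -> T) (a' : mu r -> T' -> T'),
         (T -> T') -> B T a -> B T' a' -> C) : ser C r :=
  fun n m =>
    (r ^ n * n`!)%N%:R^-1 *
    \sum_(c : {ffun 'I_n -> mu r}) \sum_(s : 'S_n)
       (ctype c s == m)%:R *
       \sum_(b : B _ (@nact r n)) M _ _ _ _ (wfun c s) b b.

Definition ch C r (U : Bmod C r) : ser C r := @chc C r (@bas C r U) (@mat C r U).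

Definition actset r (T : finType) (a : mu r -> T -> T) (g : mu r) (S : {set T}) : {set T} :=
  a g @: S.

Definition adm r (T : finType) (a : mu r -> T -> T) (P : {set {set T}}) : bool :=
  [&& partition P [set: T],
      [forall g : mu r, [forall J in P, actset a g J \in P]] &
      [forall g : mu r, [forall J in P, (actset a g J == J) ==> (g == 0)]]].

Notation admT a := {P : {set {set _}} | adm a P}.
Notation blkT P := {J : {set _} | J \in P}.

Definition blkact r (T : finType) (a : mu r -> T -> T) (P : {set {set T}})
    (g : mu r) (J : blkT P) : blkT P := insubd J (actset a g (val J)).

Definition orbs r (T : finType) (a : mu r -> T -> T) (P : {set {set T}}) : {set {set {set T}}} :=
  [set [set actset a g J | g : mu r] | J in P].

Notation OrbT a P := {O : {set {set _}} | O \in orbs a P}.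

(** chosen representative block of an orbit O; V(O) is identified with V(rep O)
    through the projection of compatible families onto their rep O component *)
Definition rep (T : finType) (O : {set {set T}}) : {set T} := odflt set0 [pick J in O].

Notation repT O := {x : _ | x \in rep O}.

Definition compBasis C r (U : Bmod C r) (V : Bmod C 1) (T : finType) (a : mu r -> T -> T)
  : finType :=
  {P : admT a & (bas U (@blkact r T a (val P)) *
                 {dffun forall O : OrbT a (val P), bas V (@triv (repT (val O)))})%type}.

Definition fimg (T T' : finType) (f : T -> T') (P : {set {set T}}) : {set {set T'}} :=
  [set f @: (J : {set T}) | J in P].

Lemma blk_mem (T T' : finType) (f : T -> T') (P : {set {set T}}) (P2 : {set {set T'}})
  (e : P2 = fimg f P) (J : blkT P) : f @: val J \in P2.
Proof. by rewrite e; apply: imset_f; exact: valP J. Qed.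

Definition blkmap (T T' : finType) (f : T -> T') (P : {set {set T}}) (P2 : {set {set T'}})
  (e : P2 = fimg f P) : blkT P -> blkT P2 :=
  fun J => Sub (f @: val J) (blk_mem e J).

(** the factor V(O) -> V(f O) of (U o V)(f), in the coordinates given by the
    representatives rep O and rep (f O): it is V(x |-> b . f x) : V(rep O) -> V(rep (f O)),
    where b in mu_r is such that b . f(rep O) = rep (f O). *)
Definition Vpart (C : numClosedFieldType) r (V : Bmod C 1) (T T' : finType)
    (a : mu r -> T -> T) (a' : mu r -> T' -> T') (f : T -> T')
    (P : {set {set T}}) (P2 : {set {set T'}})
    (v : {dffun forall O : OrbT a P, @bas C 1 V _ (@triv (repT (val O)))})
    (v2 : {dffun forall O : OrbT a' P2, @bas C 1 V _ (@triv (repT (val O)))})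
    (O : OrbT a P) : C :=
  match (insub (fimg f (val O)) : option (OrbT a' P2)) with
  | Some O2 =>
      match [pick y0 : repT (val O2)] with
      | Some y0 =>
          let b := odflt 0 [pick g : mu r |
                              actset a' g (f @: rep (val O)) == rep (val O2)] in
          @mat C 1 V _ _ (@triv (repT (val O))) (@triv (repT (val O2)))
            (fun x0 : repT (val O) => insubd y0 (a' b (f (val x0))))
            (v O) (v2 O2)
      | None => 0
      end
  | None => 0
  end.

Definition compMat C r (U : Bmod C r) (V : Bmod C 1) (T T' : finType)
    (a : mu r -> T -> T) (a' : mu r -> T' -> T') (f : T -> T')
    (x : compBasis U V a) (y : compBasis U V a') : C :=
  match val (tag y) =P fimg f (val (tag x)) with
  | ReflectT e =>
      @mat C r U _ _ (@blkact r T a (val (tag x))) (@blkact r T' a' (val (tag y)))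
        (blkmap e) (tagged x).1 (tagged y).1 *
      \prod_(O : OrbT a (val (tag x)))
         @Vpart C r V T T' a a' f (val (tag x)) (val (tag y)) (tagged x).2 (tagged y).2 O
  | ReflectF _ => 0
  end.

(* Main.v *)
(** Everything is a count of groupoids.  Labelling the mu_r-orbits of blocks
    by {1..k} turns an admissible partition of [n]_r into an equivariant
    surjection (z, j) |-> (z + d j, t j) from [n]_r to [k]_r, at the price of a
    factor 1/(r^k k!), and an automorphism w of [n]_r preserving the partition
    then covers a unique w' = (c', s') in W(r,k).  For fixed w' = (c', s'), w is
    determined by d and by the permutation s lying over s', its cycle types do
    not depend on d, and choosing bijections of the fibres of t over one point
    of each cycle O of s' with {1..nu_O} turns the pairs (t, s) into
    independent permutations sigma_O of {1..nu_O}: going once around O along s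
    is sigma_O.  A j-cycle of sigma_O yields an (e j)-cycle of w of type j z,
    where e = |O| and z is the type of O, which is the rule
    p_e(z) o p_j = p_{e j}(j z), and the trace on the tensor product of the
    spaces V(fibre) is the product of the traces of the sigma_O.

    Both sides are compared after evaluating the variables p_i(z) in an
    arbitrary commutative C-algebra, the generic evaluation being a polynomial
    ring; the degree is kept by a formal variable 'X. *)
Require Import Defs.
From HB Require Import structures.
From mathcomp Require Import all_boot all_order all_algebra all_fingroup.
From mathcomp Require Import zify mpoly.
From Stdlib Require Import FunctionalExtensionality.
Import GRing.Theory Num.Theory.
Set Implicit Arguments. Unset Strict Implicit. Unset Printing Implicit Defensive.
Local Open Scope ring_scope.

(** * Traces on tensor products *)

(** Distributivity for a family of index sets [B i]; this turns the trace of a tensor product into a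
    product of traces. *)
Lemma sum_dffun_prod (R : comNzRingType) (I : finType) (B : I -> finType)
    (F : forall i, B i -> R) :
  \sum_(v : {dffun forall i, B i}) \prod_i F i (v i) = \prod_i \sum_b F i b.
Proof.
rewrite (reindex (@dffun_of_fprod I B)) /=; last exact/onW_bij/dffun_of_fprod_bij.
pose P i := [ffun b => F i b].
transitivity (\sum_(t : fprod B) \prod_i P i (t i)).
  by apply: eq_bigr => t _; apply: eq_bigr => i _; rewrite !ffunE.
rewrite big_fprod -(bigA_distr_big_dep _ (fun i j => untag 0 (P i) j)).
apply: eq_bigr => i _; rewrite -(big_tag (fun i b => P i b)).
by apply: eq_bigr => b _; rewrite ffunE.
Qed.

Lemma sum_dffun_prod_reindex (R : comNzRingType) (I J : finType) (B : J -> finType)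
    (p : I -> J) (F : forall i, B (p i) -> R) : bijective p ->
  \sum_(v : {dffun forall j, B j}) \prod_i F i (v (p i)) = \prod_i \sum_b F i b.
Proof.
case=> p' pK p'K.
(* [F] is moved to the index set [J] along [p (p' j) = j]; the casts disappear because equality
   proofs on a finite type are unique. *)
have key i' i (e : i' = i) (b : B (p i)) (e2 : p i = p i') :
    F i' (ecast j (B j) e2 b) = F i b.
  by case: _ / e b e2 => b e2; rewrite eq_axiomK.
pose G j (b : B j) := F (p' j) (ecast j (B j) (esym (p'K j)) b).
transitivity (\sum_(v : {dffun forall j, B j}) \prod_j G j (v j)).
  apply: eq_bigr => v _; rewrite (reindex p) /=; last by exists p' => x _.
  by apply: eq_bigr => i _; rewrite /G key.
rewrite sum_dffun_prod (reindex p) /=; last by exists p' => x _.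
by apply: eq_bigr => i _; apply: eq_bigr => b _; rewrite /G key.
Qed.

Lemma sum_delta_l (R : comNzRingType) (I : finType) (i : I) (F : I -> R) :
  \sum_j (i == j)%:R * F j = F i.
Proof.
rewrite (bigD1 i) //= eqxx mul1r big1 ?addr0 // => j /negPf.
by rewrite eq_sym => ->; rewrite mul0r.
Qed.

Lemma prod_delta (R : comNzRingType) (I : finType) (P : I -> bool) :
  \prod_i (P i)%:R = [forall i, P i]%:R :> R.
Proof.
case: (boolP [forall i, P i]) => [/forallP h|/forallPn [i /negPf h]].
  by rewrite big1 // => i _; rewrite h.
by rewrite (bigD1 i) //= h mul0r.
Qed.

(** From B B' = 1, B' B = 1 and B A = A' B: tr A = tr B' B A = tr B' A' B = tr A' B B' = tr A'. *)
Lemma trace_conj (R : comNzRingType) (X Y : finType)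
    (A : X -> X -> R) (A' : Y -> Y -> R) (B : Y -> X -> R) (B' : X -> Y -> R) :
  (forall y y', \sum_x B y x * B' x y' = (y == y')%:R) ->
  (forall x x', \sum_y B' x y * B y x' = (x == x')%:R) ->
  (forall y x, \sum_x' B y x' * A x' x = \sum_y' A' y y' * B y' x) ->
  \sum_x A x x = \sum_y A' y y.
Proof.
move=> BB' B'B BA.
transitivity (\sum_x \sum_y B' x y * \sum_y' A' y y' * B y' x).
  apply: eq_bigr => x _.
  under [RHS]eq_bigr do rewrite -BA mulr_sumr.
  rewrite exchange_big /= -[LHS](sum_delta_l x (fun x' => A x' x)).
  apply: eq_bigr => x' _; rewrite -B'B mulr_suml.
  by apply: eq_bigr => y _; rewrite mulrA.
rewrite exchange_big; apply: eq_bigr => y _ /=.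
under eq_bigr do rewrite mulr_sumr.
rewrite exchange_big /= -[RHS](sum_delta_l y (fun y' => A' y y')).
apply: eq_bigr => y' _; rewrite eq_sym -BB' mulr_suml.
by apply: eq_bigr => x _; rewrite mulrCA [RHS]mulrC; congr (_ * _); rewrite mulrC.
Qed.

Lemma is_mor_inv r (T T' : finType) (a : mu r -> T -> T) (a' : mu r -> T' -> T')
    (f : T -> T') (f' : T' -> T) :
  is_mor a a' f -> cancel f f' -> cancel f' f -> is_mor a' a f'.
Proof.
move=> [_ fe] fK f'K; split; first by exists f.
by move=> g x; apply: (can_inj fK); rewrite f'K fe f'K.
Qed.

(** * Invariance of traces under isomorphisms of objects *)

Section Functor.
Variables (C : numClosedFieldType) (r : nat) (V : Bmod C r).

Lemma mat_inv (T T' : finType) (a : mu r -> T -> T) (a' : mu r -> T' -> T')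
    (f : T -> T') (f' : T' -> T) :
  is_free_act a -> is_free_act a' -> is_mor a a' f ->
  cancel f f' -> cancel f' f ->
  forall b b', \sum_b2 @mat C r V _ _ a a' f b b2 * @mat C r V _ _ a' a f' b2 b' = (b == b')%:R.
Proof.
move=> fa fa' mf fK f'K b b'.
rewrite -(mat_comp _ _ _ mf (is_mor_inv mf fK f'K)) //.
have -> : f' \o f = fun x => x by apply: functional_extensionality => x /=; rewrite fK.
exact: mat_id.
Qed.

Lemma mat_trace_conj (T T' : finType) (a : mu r -> T -> T) (a' : mu r -> T' -> T')
    (f : T -> T) (g : T' -> T') (h : T -> T') :
  is_free_act a -> is_free_act a' -> is_mor a a f -> is_mor a' a' g -> is_mor a a' h ->
  (forall x, h (f x) = g (h x)) ->
  \sum_b @mat C r V _ _ a a f b b = \sum_b @mat C r V _ _ a' a' g b b.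
Proof.
move=> fa fa' mf mg mh hfg; case: (mh) => -[h' hK h'K] _.
have mh' := is_mor_inv mh hK h'K.
symmetry; apply: (@trace_conj C _ _ (@mat C r V _ _ a' a' g) (@mat C r V _ _ a a f)
  (@mat C r V _ _ a a' h) (@mat C r V _ _ a' a h')).
- exact: mat_inv.
- exact: mat_inv.
- move=> b b'; rewrite -!mat_comp //.
  by congr (mat _ _ _); apply: functional_extensionality => x /=; rewrite hfg.
Qed.

(** Invariance of the trace of a permuted tensor product under a change of basis
    in every factor; [e] only transports along [q (p j) = s (q j)]. *)
Lemma mat_prod_trace_conj (I J : finType)
    (TI : I -> finType) (aI : forall i, mu r -> TI i -> TI i)
    (TJ : J -> finType) (aJ : forall j, mu r -> TJ j -> TJ j)
    (s : I -> I) (f : forall i, TI i -> TI (s i))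
    (p : J -> J) (g : forall j, TJ j -> TJ (p j))
    (q : J -> I) (beta : forall j, TJ j -> TI (q j)) (e : forall j, q (p j) = s (q j)) :
  (forall i, is_free_act (@aI i)) -> (forall j, is_free_act (@aJ j)) ->
  (forall i, is_mor (@aI i) (@aI (s i)) (f i)) ->
  (forall j, is_mor (@aJ j) (@aJ (p j)) (g j)) ->
  (forall j, is_mor (@aJ j) (@aI (q j)) (beta j)) ->
  bijective p -> bijective q ->
  (forall j x, f (q j) (beta j x) = ecast i (TI i) (e j) (beta (p j) (g j x))) ->
  \sum_(v : {dffun forall i, bas V (@aI i)}) \prod_i @mat C r V _ _ _ _ (f i) (v i) (v (s i)) =
  \sum_(u : {dffun forall j, bas V (@aJ j)}) \prod_j @mat C r V _ _ _ _ (g j) (u j) (u (p j)).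
Proof.
move=> orb_map fJ mf mg mbeta bp bq comm.
(* Bijectivity only asserts that an inverse exists; a finite search provides one as data for every
   [j]. *)
have ex j : {b' : TI (q j) -> TJ j | cancel (beta j) b' & cancel b' (beta j)}.
  have [bb _] := mbeta j.
  have h y : {x | beta j x == y}.
    by apply: sigW; case: bb => b' _ b'K; exists (b' y); rewrite b'K.
  exists (fun y => sval (h y)) => [x|y]; last exact/eqP/(svalP (h y)).
  by apply/(bij_inj bb)/eqP/(svalP (h _)).
pose beta' j := s2val (ex j).
have betaK j : cancel (beta j) (beta' j) := s2valP (ex j).
have beta'K j : cancel (beta' j) (beta j) := s2valP' (ex j).
have mbeta' j : is_mor (@aI (q j)) (@aJ j) (beta' j).
  exact: is_mor_inv (mbeta j) (betaK j) (beta'K j).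
(* [B] and [B'] are the tensor products of the changes of basis, with [q] matching the factors. *)
pose B (u : {dffun forall j, bas V (@aJ j)}) (v : {dffun forall i, bas V (@aI i)}) :=
  \prod_j @mat C r V _ _ _ _ (beta j) (u j) (v (q j)).
pose B' (v : {dffun forall i, bas V (@aI i)}) (u : {dffun forall j, bas V (@aJ j)}) :=
  \prod_j @mat C r V _ _ _ _ (beta' j) (v (q j)) (u j).
pose A (v v' : {dffun forall i, bas V (@aI i)}) :=
  \prod_i @mat C r V _ _ _ _ (f i) (v i) (v' (s i)).
pose A' (u u' : {dffun forall j, bas V (@aJ j)}) :=
  \prod_j @mat C r V _ _ _ _ (g j) (u j) (u' (p j)).
apply: (@trace_conj C _ _ A A' B B').
- move=> u u'; rewrite /B /B'.
  under eq_bigr do rewrite -big_split /=.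
  rewrite (sum_dffun_prod_reindex (B := fun i => bas V (@aI i))
    (fun j b => @mat C r V _ _ _ _ (beta j) (u j) b * @mat C r V _ _ _ _ (beta' j) b (u' j)) bq).
  under eq_bigr do rewrite mat_inv //.
  rewrite prod_delta; congr ((nat_of_bool _)%:R); apply/forallP/eqP => [h|-> //].
  by apply/ffunP => j; apply/eqP/h.
- move=> v v'; rewrite /B /B'.
  under eq_bigr do rewrite -big_split /=.
  rewrite (sum_dffun_prod (fun j b =>
    @mat C r V _ _ _ _ (beta' j) (v (q j)) b * @mat C r V _ _ _ _ (beta j) b (v' (q j)))).
  under eq_bigr do rewrite mat_inv //.
  rewrite prod_delta; congr ((nat_of_bool _)%:R); apply/forallP/eqP => [h|-> //].
  case: (bq) => q' qK q'K.
  by apply/ffunP => i; rewrite -[i]q'K; apply/eqP/h.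
- move=> u v; rewrite /A /A' /B.
  (* By functoriality both composites become products over [j] of matrices of composed maps, which
     [comm] identifies. *)
  transitivity (\prod_j @mat C r V _ _ _ _ (f (q j) \o beta j) (u j) (v (s (q j)))).
    under [RHS]eq_bigr do rewrite (mat_comp (fJ _) (orb_map _) (orb_map _) (mbeta _) (mf _)).
    rewrite -(sum_dffun_prod_reindex (B := fun i => bas V (@aI i)) (fun j b =>
      @mat C r V _ _ _ _ (beta j) (u j) b * @mat C r V _ _ _ _ (f (q j)) b (v (s (q j)))) bq).
    apply: eq_bigr => v' _; rewrite big_split /=; congr (_ * _).
    by rewrite (reindex q) //; case: bq => q' qK q'K; exists q' => x _.
  transitivity (\prod_j @mat C r V _ _ _ _ (beta (p j) \o g j) (u j) (v (q (p j)))).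
    apply: eq_bigr => j _.
    have -> : f (q j) \o beta j = fun x => ecast i (TI i) (e j) (beta (p j) (g j x)).
      exact: functional_extensionality (comm j).
    by case: _ / (e j).
  under eq_bigr do rewrite (mat_comp (fJ _) (fJ _) (orb_map _) (mg _) (mbeta _)).
  rewrite -(sum_dffun_prod_reindex (B := fun j => bas V (@aJ j)) (fun j b =>
      @mat C r V _ _ _ _ (g j) (u j) b * @mat C r V _ _ _ _ (beta (p j)) b (v (q (p j)))) bp).
  apply: eq_bigr => u' _; rewrite big_split /=; congr (_ * _).
  by rewrite [RHS](reindex p) //; case: bp => p' pK p'K; exists p' => x _.
Qed.

(** The dimension is the trace of the identity, and distinct natural numbers stay distinct in
    [C]. *)
Lemma card_bas_iso (T T' : finType) (a : mu r -> T -> T) (a' : mu r -> T' -> T') (h : T -> T') :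
  is_free_act a -> is_free_act a' -> is_mor a a' h -> #|bas V a| = #|bas V a'|.
Proof.
move=> fa fa' mh.
have mi (T1 : finType) (a1 : mu r -> T1 -> T1) : is_mor a1 a1 (fun x => x).
  by split => //; exists id.
have := mat_trace_conj fa fa' (mi _ _) (mi _ _) mh (fun _ => erefl).
under eq_bigr do rewrite mat_id // eqxx.
under [RHS]eq_bigr do rewrite mat_id // eqxx.
by rewrite !sumr_const => /eqP; rewrite eqr_nat => /eqP.
Qed.

End Functor.

(** * Evaluation of series *)

Lemma extE r n (m : mono r n) (kz : 'I_n * mu r) : ext m kz.1 kz.2 = m kz.
Proof. by rewrite /ext valK; case: kz. Qed.

Lemma ext_out r n (m : mono r n) j z : (n <= j)%N -> ext m j z = 0%N.
Proof. by move=> h; rewrite /ext insubN // -leqNgt. Qed.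

Lemma mono_ext_inj r n (m1 m2 : mono r n) :
  (forall kz : 'I_n * mu r, ext m1 kz.1 kz.2 = ext m2 kz.1 kz.2) -> m1 = m2.
Proof. by move=> h; apply/ffunP => kz; apply/val_inj; rewrite /= -!extE. Qed.

(** Variables with index [j >= n] have exponent 0 in a monomial of degree [n], so the range of
    variables can be enlarged. *)
Lemma big_ext (R : Type) (idx : R) (op : Monoid.com_law idx) r n N (m : mono r n)
    (G : nat -> mu r -> nat -> R) :
  (n <= N)%N -> (forall j z, G j z 0%N = idx) ->
  \big[op/idx]_(kz : 'I_N * mu r) G kz.1 kz.2 (ext m kz.1 kz.2) =
  \big[op/idx]_(kz : 'I_n * mu r) G kz.1 kz.2 (m kz).
Proof.
move=> nN G0.
have E M : \big[op/idx]_(kz : 'I_M * mu r) G kz.1 kz.2 (ext m kz.1 kz.2) =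
    \big[op/idx]_(j < M) \big[op/idx]_(z : mu r) G j z (ext m j z).
  by rewrite pair_big.
under [RHS]eq_bigr do rewrite -extE.
rewrite !E (big_ord_widen _ (fun j => \big[op/idx]_(z : mu r) G j z (ext m j z)) nN).
rewrite big_mkcond [RHS]big_mkcond; apply: eq_bigr => j _.
case: ltnP => // h; apply: big1 => z _; by rewrite ext_out.
Qed.

(** [inord] is faithful once the exponents [q] have total weight [n], since an exponent never
    exceeds the weight. *)
Definition mono_of r n (q : nat -> mu r -> nat) : mono r n :=
  [ffun kz : 'I_n * mu r => inord (q kz.1 kz.2)].

Lemma weight_ge r n (q : nat -> mu r -> nat) (kz : 'I_n * mu r) :
  (q kz.1 kz.2 <= \sum_(kz' : 'I_n * mu r) kz'.1.+1 * q kz'.1 kz'.2)%N.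
Proof. by rewrite (bigD1 kz) //= mulSn -!addnA leq_addr. Qed.

Section MonoOf.
Variables (r n : nat) (q : nat -> mu r -> nat).
Hypothesis qn : (\sum_(kz : 'I_n * mu r) kz.1.+1 * q kz.1 kz.2)%N = n.

Lemma mono_ofE (kz : 'I_n * mu r) : mono_of n q kz = q kz.1 kz.2 :> nat.
Proof. by rewrite ffunE inordK // ltnS -[X in (_ <= X)%N]qn weight_ge. Qed.

Lemma weight_mono_of : weight (mono_of n q) = n.
Proof. by rewrite -[RHS]qn; apply: eq_bigr => kz _; rewrite mono_ofE. Qed.

(** The indicators in [smul] and [pvar] prescribe every exponent, so a single monomial survives. *)
Lemma sum_mono_of (R : comNzRingType) (F : mono r n -> R) :
  \sum_(m : mono r n | weight m == n)
     [forall kz : 'I_n * mu r, ext m kz.1 kz.2 == q kz.1 kz.2]%:R * F m = F (mono_of n q).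
Proof.
rewrite (bigD1 (mono_of n q)) ?weight_mono_of //= big1 ?addr0 => [|m].
  case: forallP => [_|[]]; first by rewrite mul1r.
  by move=> kz; rewrite extE mono_ofE.
case/andP => _ ne; case: forallP => [h|]; last by rewrite mul0r.
case/eqP: ne; apply: mono_ext_inj => kz.
by rewrite [RHS]extE mono_ofE; apply/eqP/h.
Qed.
End MonoOf.

(** * Evaluation of products and plethysms *)

Section Eval.
Variables (C : numClosedFieldType) (r : nat).

(** [x j z] is the value given to p_{j+1}(z). *)
Definition mev (S : comNzRingType) (x : nat -> mu r -> S) n (m : mono r n) : S :=
  \prod_(kz : 'I_n * mu r) x kz.1 kz.2 ^+ m kz.

Lemma mev_ext (S : comNzRingType) (x : nat -> mu r -> S) n N (m : mono r n) : (n <= N)%N ->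
  mev x m = \prod_(kz : 'I_N * mu r) x kz.1 kz.2 ^+ ext m kz.1 kz.2.
Proof. by move=> h; rewrite (big_ext (G := fun j z e => x j z ^+ e) _ _ h). Qed.

Lemma weight_ext n N (m : mono r n) : (n <= N)%N ->
  weight m = (\sum_(kz : 'I_N * mu r) kz.1.+1 * ext m kz.1 kz.2)%N.
Proof.
move=> h; rewrite (big_ext (G := fun j z e => (j.+1 * e)%N) _ _ h) // => j z.
by rewrite muln0.
Qed.

Lemma mev_mono_of (S : comNzRingType) (x : nat -> mu r -> S) n (q : nat -> mu r -> nat) :
  (\sum_(kz : 'I_n * mu r) kz.1.+1 * q kz.1 kz.2)%N = n ->
  mev x (mono_of n q) = \prod_(kz : 'I_n * mu r) x kz.1 kz.2 ^+ q kz.1 kz.2.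
Proof. by move=> h; apply: eq_bigr => kz _; rewrite mono_ofE. Qed.

Section OneRing.
Variables (S : comNzRingType) (io : {rmorphism C -> S}).
Implicit Types (x : nat -> mu r -> S) (f g : ser C r).

(** The degree [n] part of [f] at the point [x]; the condition on the weight discards the values of
    [f] that encode no coefficient. *)
Definition ev n x f : S := \sum_(m : mono r n | weight m == n) io (f n m) * mev x m.

Lemma ev_smul n x f g :
  ev n x (smul f g) = \sum_(k < n.+1) ev k x f * ev (n - k) x g.
Proof.
rewrite /ev /smul.
under eq_bigr do rewrite rmorph_sum mulr_suml /=.
rewrite exchange_big; apply: eq_bigr => k _ /=.
have kn : (k <= n)%N by rewrite -ltnS.
rewrite big_distrlr /=.
under eq_bigr do rewrite rmorph_sum mulr_suml /=.
rewrite exchange_big [RHS]big_mkcond /=; apply: eq_bigr => m1 _.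
under eq_bigr do rewrite rmorph_sum mulr_suml /=.
rewrite exchange_big /=; case: eqP => w1; last first.
  by rewrite big1 // => m2 _; rewrite big1 // => m _; rewrite mul0r rmorph0 mul0r.
rewrite [RHS]big_mkcond; apply: eq_bigr => m2 _ /=.
case: eqP => w2; last by rewrite big1 // => m _; rewrite mul0r rmorph0 mul0r.
(* A product of monomials of weights [k] and [n - k] has the added exponents, hence weight [n], and
   is the only [m] selected. *)
pose q j z := (ext m1 j z + ext m2 j z)%N.
have qn : (\sum_(kz : 'I_n * mu r) kz.1.+1 * q kz.1 kz.2)%N = n.
  under eq_bigr do rewrite mulnDr.
  by rewrite big_split /= -!weight_ext ?leq_subr // w1 w2 subnKC.
transitivity (\sum_(m : mono r n | weight m == n)
     [forall kz : 'I_n * mu r, ext m kz.1 kz.2 == q kz.1 kz.2]%:R *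
     (io (f k m1) * io (g (n - k)%N m2) * mev x m)).
  by apply: eq_bigr => m _; rewrite /= !rmorphM rmorph_nat !mulrA.
rewrite sum_mono_of // mev_mono_of // (mev_ext x m1 kn) (mev_ext x m2 (leq_subr k n)).
rewrite mulrACA -big_split; congr (_ * _).
by apply: eq_bigr => kz _; rewrite exprD.
Qed.

Lemma mono0_eq (m1 m2 : mono r 0) : m1 = m2.
Proof. by apply/ffunP => -[[]]. Qed.

Lemma ev_sone n x : ev n x (@sone C r) = (n == 0)%N%:R.
Proof.
rewrite /ev /sone; case: n => [|n] /=; last first.
  by rewrite big1 // => m _; rewrite rmorph0 mul0r.
have w0 : weight ([ffun=> ord0] : mono r 0) == 0%N.
  by rewrite /weight big1 // => -[[]].
rewrite (bigD1 _ w0) big1 /=; last by move=> m /andP[_ /eqP []]; exact: mono0_eq.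
by rewrite /mev big1 ?mulr1 ?rmorph1 ?addr0 // => -[[]].
Qed.

(** The formal variable keeps the degree; the bound [N] lets a truncated polynomial stand for a
    whole series. *)
Definition represents N x f (p : {poly S}) := forall n, (n <= N)%N -> p`_n = ev n x f.

Lemma represents_sone N x : represents N x (@sone C r) 1.
Proof. by move=> n _; rewrite ev_sone coef1. Qed.

Lemma represents_smul N x f g p q :
  represents N x f p -> represents N x g q -> represents N x (smul f g) (p * q).
Proof.
move=> hp hq n nN; rewrite ev_smul coefM; apply: eq_bigr => k _.
by rewrite hp ?hq // ?(leq_trans (leq_subr _ _)) // (leq_trans _ nN) // -ltnS.
Qed.

Lemma represents_spow N x f p e : represents N x f p -> represents N x (spow f e) (p ^+ e).
Proof.
move=> hp; elim: e => [|e IH]; first exact: represents_sone.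
by rewrite exprS; apply: represents_smul.
Qed.

Lemma represents_prod N x (I : finType) (F : I -> ser C r) (P : I -> {poly S}) :
  (forall i, represents N x (F i) (P i)) ->
  represents N x (\big[@smul C r / @sone C r]_i F i) (\prod_i P i).
Proof.
move=> h; apply: (big_ind2 (fun f p => represents N x f p)) => //.
  exact: represents_sone.
by move=> f p g q; apply: represents_smul.
Qed.
End OneRing.

(** Plethysm is evaluated by substituting in [f], for each [p_{j+1}(z)], a polynomial representing
    [p_{j+1}(z) o g], and reading off the coefficient of degree [n]. *)
Lemma ev_pleth (S : comNzRingType) (io : {rmorphism C -> S}) n (x : nat -> mu r -> S)
    (f : ser C r) (g : ser C 1) (Y : nat -> mu r -> {poly S}) :
  (forall j z, represents io n x (pvar j.+1 z g) (Y j z)) ->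
  ev io n x (pleth f g) = \sum_(k < n.+1) (ev (polyC \o io) k Y f)`_n.
Proof.
move=> hY; rewrite /ev /pleth.
under eq_bigr do rewrite rmorph_sum mulr_suml /=.
rewrite exchange_big; apply: eq_bigr => k _ /=.
rewrite coef_sum [RHS]big_mkcond /=.
under eq_bigr do rewrite rmorph_sum mulr_suml /=.
rewrite exchange_big; apply: eq_bigr => m _ /=; case: eqP => w; last first.
  by rewrite big1 // => M _; rewrite !mul0r rmorph0 mul0r.
rewrite coefCM.
have := @represents_prod _ io n x _ (fun kz : 'I_k * mu r => spow (pvar kz.1.+1 kz.2 g) (m kz))
  (fun kz => Y kz.1 kz.2 ^+ m kz) (fun kz => @represents_spow _ io n x _ _ (m kz) (hY kz.1 kz.2)).
move=> /(_ n (leqnn n)) ->; rewrite /ev mulr_sumr; apply: eq_bigr => M _.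
by rewrite mul1r rmorphM mulrA.
Qed.

(** The multiples of [i] among 1, ..., il are i, 2i, ..., li, with indices lowered by one. Each
    induction step adds a block of [i] indices, of which only the last is a multiple. *)
Lemma big_dvd (R : Type) (idx : R) (op : Monoid.com_law idx) i l (F : nat -> R) :
  (0 < i)%N -> \big[op/idx]_(j < i * l | (i %| j.+1)%N) F j =
  \big[op/idx]_(j < l) F (i * j.+1).-1.
Proof.
move=> i0; elim: l => [|l IH]; first by rewrite muln0 !big_ord0.
rewrite big_ord_recr /= -IH -!(big_mkord (fun j => i %| j.+1)%N F).
have le : (i * l <= i * l.+1)%N by rewrite leq_mul2l leqnSn orbT.
rewrite (big_cat_nat _ (n := (i * l)%N)) //=; congr (op _ _).
have lt : (i * l <= (i * l.+1).-1)%N by nia.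
rewrite -(prednK (_ : 0 < i * l.+1)%N) ?muln_gt0 ?i0 // big_mkcond big_nat_recr //=.
rewrite prednK ?muln_gt0 ?i0 // dvdn_mulr // big1_seq ?Monoid.mul1m //= => j.
rewrite mem_index_iota => /andP[h1 h2]; case: ifP => // /dvdnP[q hq].
(* The multiple [q i] would lie strictly between [i l] and [i (l + 1)]. *)
have : (l < q < l.+1)%N by rewrite -(ltn_pmul2l i0) -[(q < _)%N](ltn_pmul2l i0); nia.
by lia.
Qed.

(** The exponents [dil i z b] vanish except at the variables p_{ij}(j z), where they are those of
    p_j in [b]. *)
Lemma big_dil (R : Type) (idx : R) (op : Monoid.com_law idx) i (z : mu r) l (b : mono 1 l)
    (G : nat -> mu r -> nat -> R) : (0 < i)%N -> (forall j z, G j z 0%N = idx) ->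
  \big[op/idx]_(kz : 'I_(i * l) * mu r) G kz.1 kz.2 (dil i z b kz.1 kz.2) =
  \big[op/idx]_(kz : 'I_l * mu 1) G (i * kz.1.+1).-1 (z *+ kz.1.+1) (b kz).
Proof.
move=> i0 G0.
rewrite -(pair_big xpredT xpredT (fun (j : 'I_(i * l)) z' => G j z' (dil i z b j z'))) /=.
transitivity (\big[op/idx]_(j < i * l | (i %| j.+1)%N)
    G j (z *+ (j.+1 %/ i)) (ext b (j.+1 %/ i).-1 (0 : mu 1))).
  rewrite [RHS]big_mkcond; apply: eq_bigr => j _; rewrite /dil.
  case: ifP => _; last by rewrite big1.
  rewrite (bigD1 (z *+ (j.+1 %/ i))) //= eqxx big1 ?Monoid.mulm1 // => z' /negPf ->.
  exact: G0.
rewrite (big_dvd _ _ (fun j => G j (z *+ (j.+1 %/ i)) (ext b (j.+1 %/ i).-1 (0 : mu 1)))) //.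
under [RHS]eq_bigr do rewrite -(extE b).
rewrite -(pair_big xpredT xpredT (fun (j : 'I_l) z' =>
  G (i * j.+1).-1 (z *+ j.+1) (ext b j z'))) /=.
by apply: eq_bigr => j _; rewrite big_ord1 prednK ?muln_gt0 ?i0 ?mulKn.
Qed.

(** The values of p_i(z) o p_{j+1} = p_{i(j+1)}((j+1) z). *)
Definition dilx (S : comNzRingType) (x : nat -> mu r -> S) i (z : mu r) (j : nat) (_ : mu 1) : S :=
  x (i * j.+1).-1 (z *+ j.+1).
End Eval.

(** Replacing p_j by p_{ij}(j z) in [g] and evaluating at [x] is evaluating [g] at the dilated
    point; degrees are multiplied by [i]. *)
Lemma ev_pvar (C : numClosedFieldType) r (S : comNzRingType) (io : {rmorphism C -> S}) n
    (x : nat -> mu r -> S) (g : ser C 1) i (z : mu r) : (0 < i)%N ->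
  ev io n x (pvar i z g) = if (i %| n)%N then ev io (n %/ i) (dilx x i z) g else 0.
Proof.
move=> i0; rewrite /ev /pvar; case: ifP => [/dvdnP[l ->]|_]; last first.
  by rewrite big1 // => m _; rewrite rmorph0 mul0r.
rewrite mulnK // mulnC.
under eq_bigr do rewrite rmorph_sum mulr_suml /=.
rewrite exchange_big [RHS]big_mkcond; apply: eq_bigr => b _ /=.
case: eqP => w; last by rewrite big1 // => m _; rewrite mul0r rmorph0 mul0r.
have qn : (\sum_(kz : 'I_(i * l) * mu r) kz.1.+1 * dil i z b kz.1 kz.2)%N = (i * l)%N.
  rewrite (big_dil (G := fun j _ e => (j.+1 * e)%N) _ z b) //; last by move=> j _; rewrite muln0.
  rewrite -[l in RHS]w /weight big_distrr; apply: eq_bigr => kz _ /=.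
  by rewrite prednK ?muln_gt0 ?i0 // mulnA.
transitivity (\sum_(m : mono r (i * l) | weight m == (i * l)%N)
     [forall kz : 'I_(i * l) * mu r, ext m kz.1 kz.2 == dil i z b kz.1 kz.2]%:R *
     (io (g l b) * mev x m)).
  by apply: eq_bigr => m _; rewrite /= !rmorphM rmorph_nat !mulrA.
rewrite sum_mono_of // mev_mono_of //; congr (_ * _).
by rewrite (big_dil (G := fun j z' e => x j z' ^+ e) _ z b).
Qed.

(** * Cycle types and the evaluation of characteristics *)

(** The value of p_w at [x]; the index is [#|O|.-1] because [x j] stands for [p_{j+1}]. *)
Definition wev r (S : comNzRingType) (x : nat -> mu r -> S) n (c : {ffun 'I_n -> mu r})
    (s : 'S_n) : S :=
  \prod_(O in porbits s) x #|O|.-1 (\sum_(i in O) c i).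

Lemma card_porbit_mem n (s : 'S_n) O : O \in porbits s -> (0 < #|O| <= n)%N.
Proof.
case/imsetP => i _ ->; apply/andP; split.
  by rewrite card_gt0; apply/set0Pn; exists i; exact: porbit_id.
by apply: leq_trans (max_card _) _; rewrite card_ord.
Qed.

Lemma mem_porbits_eq (T : finType) (s : {perm T}) O i :
  O \in porbits s -> (i \in O) = (porbit s i == O).
Proof.
by case/imsetP => j _ ->; rewrite eq_porbit_mem porbit_sym.
Qed.

Lemma sum_card_porbits n (s : 'S_n) : (\sum_(O in porbits s) #|O|)%N = n.
Proof.
rewrite -[RHS]card_ord -sum1_card.
rewrite (partition_big (porbit s) (mem (porbits s))) /=; last by move=> i _; exact: imset_f.
apply: eq_bigr => O hO; rewrite -sum1_card; apply: eq_bigl => i.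
exact: mem_porbits_eq.
Qed.

(** The cycle lengths are positive with sum [n], so there are at most [n] cycles and [inord]
    truncates nothing. *)
Lemma ctypeE r n (c : {ffun 'I_n -> mu r}) (s : 'S_n) kz :
  ctype c s kz = #|[set O in porbits s |
        (#|O| == kz.1.+1) && (\sum_(i in O) c i == kz.2)]| :> nat.
Proof.
rewrite ffunE inordK // ltnS.
apply: (@leq_trans (\sum_(O in porbits s) #|O|)%N); last by rewrite sum_card_porbits.
rewrite -sum1_card.
rewrite big_mkcond [X in (_ <= X)%N]big_mkcond leq_sum // => O _.
rewrite inE; case: (boolP (O \in _)) => //= hO.
by case/andP: (card_porbit_mem hO) => h _; case: ifP.
Qed.

(** Cycles are grouped by length and type. The monoid is left general so that the statement serves
    both the weight (sums) and the evaluation (products). *)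
Lemma prod_ctype (R : Type) (idx : R) (op : Monoid.com_law idx) r n
    (c : {ffun 'I_n -> mu r}) (s : 'S_n) (F : nat -> mu r -> R) :
  \big[op/idx]_(kz : 'I_n * mu r) iterop (ctype c s kz) op (F kz.1 kz.2) idx =
  \big[op/idx]_(O in porbits s) F #|O|.-1 (\sum_(i in O) c i).
Proof.
(* For [n = 0] both sides are empty; a successor lets [inord] hold the lowered length. *)
case: n c s => [|n] c s.
  rewrite !big1 // => [O hO|[[] //]].
  by case/andP: (card_porbit_mem hO) => /leq_trans h /h.
rewrite [RHS](partition_big (fun O : {set 'I_n.+1} =>
  (inord #|O|.-1 : 'I_n.+1, \sum_(i in O) c i)) xpredT) //=.
apply: eq_bigr => kz _; rewrite ctypeE Monoid.iteropE -big_const.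
rewrite big_mkcond [RHS]big_mkcond; apply: eq_bigr => O _; rewrite inE.
case: (boolP (O \in _)) => //= hO; case/andP: (card_porbit_mem hO) => h1 h2.
have e : (inord #|O|.-1 : 'I_n.+1) = #|O|.-1 :> nat by rewrite inordK // prednK.
case: kz => j z /=; rewrite xpair_eqE.
have -> : (inord #|O|.-1 == j) = (#|O| == j.+1) by rewrite -val_eqE /= e -eqSS prednK.
by case: ifP => // /andP [/eqP -> /eqP ->].
Qed.

Lemma weight_ctype r n (c : {ffun 'I_n -> mu r}) (s : 'S_n) : weight (ctype c s) = n.
Proof.
rewrite -[RHS](sum_card_porbits s) /weight.
rewrite -(eq_bigr _ (fun O (hO : O \in porbits s) => _ : #|O|.-1.+1 = #|O|)); last first.
  by move=> O hO; rewrite prednK //; case/andP: (card_porbit_mem hO).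
rewrite -(prod_ctype _ c s (fun j _ => j.+1)).
by apply: eq_bigr => kz _; rewrite Monoid.iteropE iter_addn_0.
Qed.

Lemma mev_ctype r (S : comNzRingType) (x : nat -> mu r -> S) n
    (c : {ffun 'I_n -> mu r}) (s : 'S_n) : mev x (ctype c s) = wev x c s.
Proof.
by rewrite /wev -(prod_ctype _ c s x).
Qed.

(** Each [w] contributes to the monomial [ctype c s] only. Stated for raw data, the formula covers
    [ch] and the composite alike. *)
Lemma ev_chc (C : numClosedFieldType) r (S : comNzRingType) (io : {rmorphism C -> S}) n
    (x : nat -> mu r -> S) (B : forall T : finType, (mu r -> T -> T) -> finType)
    (M : forall (T T' : finType) (a : mu r -> T -> T) (a' : mu r -> T' -> T'),
         (T -> T') -> B T a -> B T' a' -> C) :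
  ev io n x (chc M) = io ((r ^ n * n`!)%N%:R^-1) *
   \sum_(c : {ffun 'I_n -> mu r}) \sum_(s : 'S_n)
      wev x c s * io (\sum_(b : B _ (@nact r n)) M _ _ _ _ (wfun c s) b b).
Proof.
rewrite /ev /chc.
under eq_bigr do rewrite rmorphM -mulrA.
rewrite -mulr_sumr; congr (_ * _).
under eq_bigr do rewrite rmorph_sum mulr_suml.
rewrite exchange_big; apply: eq_bigr => c _ /=.
under eq_bigr do rewrite rmorph_sum mulr_suml.
rewrite exchange_big; apply: eq_bigr => s _ /=.
rewrite (bigD1 (ctype c s)) ?weight_ctype //= eqxx mul1r mev_ctype mulrC.
rewrite [X in _ + X]big1 ?addr0 //.
by move=> m /andP[_ /negPf]; rewrite eq_sym => ->; rewrite mul0r rmorph0 mul0r.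
Qed.

(** Evaluation at independent polynomial variables separates the coefficients, as distinct monomials
    have distinct exponent vectors. *)
Lemma ev_inj (C : numClosedFieldType) r n (f g : ser C r) :
  (forall (S : comNzRingType) (io : {rmorphism C -> S}) (x : nat -> mu r -> S),
     ev io n x f = ev io n x g) ->
  forall m : mono r n, weight m = n -> f n m = g n m.
Proof.
move=> h m wm.
pose N := #|{: 'I_n * mu r}|.
pose S := {mpoly C[N]}.
pose x (j : nat) (z : mu r) : S :=
  if (insub j : option 'I_n) is Some j' then 'X_(enum_rank (j', z)) else 0.
pose mm (m' : mono r n) : 'X_{1..N} := [multinom (m' (enum_val i) : nat) | i < N].
have evx (m' : mono r n) : mev x m' = 'X_[mm m'].
  rewrite mpolyXE_id /mev (reindex (@enum_val _ {: 'I_n * mu r})) /=; last first.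
    by apply: onW_bij; exact: enum_val_bij.
  apply: eq_bigr => i _; rewrite mnmE /x valK.
  by rewrite -surjective_pairing enum_valK.
have mm_inj : injective mm.
  move=> m1 m2 e; apply/ffunP => kz; apply/val_inj => /=.
  by have := congr1 (fun M : 'X_{1..N} => M (enum_rank kz)) e; rewrite !mnmE enum_rankK.
have ex (q : ser C r) : (ev (@mpolyC N C) n x q)@_(mm m) = q n m.
  rewrite /ev raddf_sum /= (bigD1 m) ?wm //= big1 ?addr0 => [|m' /andP[_ ne]].
    by rewrite evx mul_mpolyC mcoeffZ mcoeffX eqxx mulr1.
  by rewrite evx mul_mpolyC mcoeffZ mcoeffX (inj_eq mm_inj) (negPf ne) mulr0.
by rewrite -!ex h.
Qed.

(** * Labelled partitions *)

Lemma nact_free r n : is_free_act (@nact r n).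
Proof.
split; rewrite /nact; first by case=> z i; rewrite add0r.
  by move=> g h x; rewrite addrA.
by move=> g [z i] [] /= e; apply: (addIr z); rewrite e add0r.
Qed.

Lemma wfun_mor r n (c : {ffun 'I_n -> mu r}) (s : 'S_n) :
  is_mor (@nact r n) (@nact r n) (wfun c s).
Proof.
split; last by move=> g x; rewrite /wfun /nact addrA.
exists (fun x => (x.1 - c (s^-1%g x.2), s^-1%g x.2)) => -[z i]; rewrite /wfun /=.
  by rewrite permK addrK.
by rewrite permKV subrK.
Qed.

Section Labelling.
Variables r n : nat.
Notation X := (mu r * 'I_n)%type.
Notation act := (actset (@nact r n)).
Implicit Types (P : {set {set X}}) (J : {set X}) (d : {ffun 'I_n -> mu r}).

Lemma nact0 (x : X) : nact 0 x = x.
Proof. by case: (nact_free r n). Qed.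
Lemma nactD g h (x : X) : nact (g + h) x = nact g (nact h x).
Proof. by case: (nact_free r n). Qed.
Lemma nactK g : cancel (@nact r n g) (nact (- g)).
Proof. by move=> x; rewrite -nactD addNr nact0. Qed.
Lemma nactVK g : cancel (nact (- g)) (@nact r n g).
Proof. by move=> x; rewrite -nactD addrN nact0. Qed.

Lemma mem_actset g J x : (x \in act g J) = (nact (- g) x \in J).
Proof.
apply/imsetP/idP => [[y yJ ->]|h]; first by rewrite nactK.
by exists (nact (- g) x); rewrite ?nactVK.
Qed.
Lemma actset0 J : act 0 J = J.
Proof. by apply/setP => x; rewrite mem_actset oppr0 nact0. Qed.
Lemma actsetD g h J : act (g + h) J = act g (act h J).
Proof. by apply/setP => x; rewrite !mem_actset -nactD opprD addrC. Qed.

(** The general equivariant map from [[n]_r] to [[k]_r], which is determined by its values at the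
    points (0, j). *)
Definition phi k d (t : {ffun 'I_n -> 'I_k}) (x : X) : mu r * 'I_k :=
  (x.1 + d x.2, t x.2).
Definition fib k d (t : {ffun 'I_n -> 'I_k}) (y : mu r * 'I_k) : {set X} :=
  [set x | phi d t x == y].
Definition fibs k d (t : {ffun 'I_n -> 'I_k}) : {set {set X}} :=
  [set fib d t y | y : mu r * 'I_k].
Definition surjb k (t : {ffun 'I_n -> 'I_k}) := [forall i, exists j, t j == i].

Lemma phi_nact k d (t : {ffun 'I_n -> 'I_k}) g x :
  @phi k d (t : {ffun 'I_n -> 'I_k}) (nact g x) = nact g (phi d t x).
Proof. by rewrite /phi /nact /= addrA. Qed.

Lemma phi_surj k d (t : {ffun 'I_n -> 'I_k}) : surjb t -> forall y, exists x, phi d t x = y.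
Proof.
move=> /forallP h [z i]; have /existsP[j /eqP tj] := h i.
by exists (z - d j, j); rewrite /phi /= subrK tj.
Qed.

Lemma actset_fib k d (t : {ffun 'I_n -> 'I_k}) g y :
  act g (@fib k d (t : {ffun 'I_n -> 'I_k}) y) = fib d t (nact g y).
Proof.
apply/setP => x; rewrite mem_actset !inE phi_nact.
by rewrite (can2_eq (f := @nact r k (- g)) (g := @nact r k g)) // => u;
  rewrite /nact /= ?addNKr ?addrA ?addrN ?addNr ?add0r -?surjective_pairing.
Qed.

Lemma fib_inj k d (t : {ffun 'I_n -> 'I_k}) : @surjb k t -> injective (fib d t).
Proof.
move=> st y y' e; have [x xy] := phi_surj d st y.
by have : x \in fib d t y; [rewrite inE xy | rewrite e inE xy => /eqP].
Qed.

(** The group permutes the fibres as it permutes the points of [[k]_r]; surjectivity makes the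
    fibres nonempty and distinct, so freeness carries over. *)
Lemma fibs_adm k d (t : {ffun 'I_n -> 'I_k}) : @surjb k t -> adm (@nact r n) (fibs d t).
Proof.
move=> st; apply/and3P; split.
- apply/and3P; split.
  + apply/eqP/setP => x; rewrite inE; apply/bigcupP.
    by exists (fib d t (phi d t x)); [exact: imset_f | rewrite inE].
  + apply/trivIsetP => _ _ /imsetP[y _ ->] /imsetP[y' _ ->] ne.
    rewrite -setI_eq0; apply/eqP/setP => x; rewrite !inE.
    by apply/negP => /andP[/eqP e /eqP e']; case/eqP: ne; rewrite -e -e'.
  + apply/negP => /imsetP[y _ e]; have [x xy] := phi_surj d st y.
    by have := in_set0 x; rewrite e inE xy eqxx.
- apply/forallP => g; apply/forall_inP => _ /imsetP[y _ ->].
  by rewrite actset_fib; exact: imset_f.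
- apply/forallP => g; apply/forall_inP => _ /imsetP[y _ ->]; apply/implyP.
  rewrite actset_fib => /eqP /(fib_inj st) e.
  by case: (nact_free r k) => _ _ h; apply/eqP/(h _ y).
Qed.

Lemma card_fibs k d (t : {ffun 'I_n -> 'I_k}) : @surjb k t -> #|fibs d t| = (r.-1.+1 * k)%N.
Proof. by move=> st; rewrite card_imset ?card_prod ?card_ord //; exact: fib_inj. Qed.

Lemma fibs_kernel k d (t : {ffun 'I_n -> 'I_k}) k' d' t' : fibs d t = fibs d' t' ->
  forall x y, @phi k d t x = phi d t y -> @phi k' d' t' x = phi d' t' y.
Proof.
move=> e x y exy.
have /imsetP[y' _ ey'] : fib d t (phi d t x) \in fibs d' t' by rewrite -e imset_f.
have : x \in fib d t (phi d t x) by rewrite inE.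
have : y \in fib d t (phi d t x) by rewrite inE exy.
by rewrite ey' !inE => /eqP -> /eqP ->.
Qed.

Lemma kernel_fibs k d (t : {ffun 'I_n -> 'I_k}) k' d' t' : @surjb k t -> @surjb k' t' ->
  (forall x y, (@phi k d t x == phi d t y) = (@phi k' d' t' x == phi d' t' y)) ->
  fibs d t = fibs d' t'.
Proof.
move=> st st' h.
have E x : fib d t (phi d t x) = fib d' t' (phi d' t' x).
  by apply/setP => y; rewrite !inE h.
apply/setP => J; apply/imsetP/imsetP => -[y _ ->].
  have [x <-] := phi_surj d st y; by exists (phi d' t' x).
by have [x <-] := phi_surj d' st' y; exists (phi d t x).
Qed.

(** Two surjections with the same kernel differ by a bijection of the target, which equivariance
    places in [W(r,k)]. *)
Lemma kernel_wfun k d (t : {ffun 'I_n -> 'I_k}) d' t' : @surjb k t -> @surjb k t' ->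
  (forall x y, phi d t x = phi d t y -> phi d' t' x = phi d' t' y) ->
  (forall x y, phi d' t' x = phi d' t' y -> phi d t x = phi d t y) ->
  exists c s, forall x, phi d' t' x = wfun c s (phi d t x).
Proof.
move=> st st' h h'.
(* Preimages of the points (0, i); their images under the second labelling give the entries of [c]
   and [s]. *)
have hx i : {x | phi d t x == (0, i)}.
  by apply: sigW; have [x xe] := phi_surj d st (0, i); exists x; rewrite xe.
pose X_ i := sval (hx i); have XE i : phi d t (X_ i) = (0, i) by apply/eqP/(svalP (hx i)).
pose s0 i := (phi d' t' (X_ i)).2.
have nE (g : mu r) (m : nat) (y : mu r * 'I_m) : nact g y = (g + y.1, y.2) by [].
have s0i : injective s0.
  move=> i j e.
  (* If two of these images share an orbit, a translate of one equals the other, and the kernels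
     then force [i = j]. *)
  have e1 : phi d' t' (X_ i) =
      phi d' t' (nact ((phi d' t' (X_ i)).1 - (phi d' t' (X_ j)).1) (X_ j)).
    by rewrite phi_nact nE subrK -/(s0 j) -e [LHS]surjective_pairing.
  by have := h' _ _ e1; rewrite phi_nact !XE => -[].
exists [ffun i => (phi d' t' (X_ i)).1], (perm s0i) => x.
have e : phi d t x = phi d t (nact (phi d t x).1 (X_ (phi d t x).2)).
  by rewrite phi_nact XE nE addr0 -surjective_pairing.
by rewrite (h _ _ e) phi_nact nE /wfun ffunE permE.
Qed.

Lemma wfun_phi_unique k d (t : {ffun 'I_n -> 'I_k}) c s c' s' : @surjb k t ->
  (forall x, wfun c s (phi d t x) = wfun c' s' (phi d t x)) -> c = c' /\ s = s'.
Proof.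
move=> st h.
have E i : c i = c' i /\ s i = s' i.
  have [x xe] := phi_surj d st (0, i); have := h x; rewrite xe /wfun /= !add0r.
  by case.
by split; [apply/ffunP | apply/permP] => i; case: (E i).
Qed.

Lemma phi_wfun k d (t : {ffun 'I_n -> 'I_k}) (c : {ffun 'I_k -> mu r}) (s : 'S_k) x :
  phi [ffun j => d j + c (t j)] [ffun j => s (t j)] x = wfun c s (@phi k d t x).
Proof. by rewrite /phi /wfun !ffunE /= addrA. Qed.

Lemma surjb_comp k (t : {ffun 'I_n -> 'I_k}) (s : 'S_k) : surjb t -> surjb [ffun j => s (t j)].
Proof.
move=> /forallP h; apply/forallP => i; have /existsP[j /eqP e] := h (s^-1%g i).
by apply/existsP; exists j; rewrite ffunE e permKV.
Qed.

Lemma surjb_leq k (t : {ffun 'I_n -> 'I_k}) : surjb t -> (k <= n)%N.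
Proof.
move=> /forallP h.
rewrite -[k]card_ord -[n]card_ord -(_ : #|codom t| = #|'I_k|) ?leq_image_card //.
apply: eq_card => i; rewrite inE; have /existsP[j /eqP <-] := h i; exact: codom_f.
Qed.

Lemma phi_ext k d (t : {ffun 'I_n -> 'I_k}) d' t' :
  (forall x, @phi k d (t : {ffun 'I_n -> 'I_k}) x = @phi k d' t' x) -> d = d' /\ t = t'.
Proof.
move=> h; have E j : d j = d' j /\ t j = t' j.
  by have := h (0, j); rewrite /phi /= !add0r => -[].
by split; apply/ffunP => j; case: (E j).
Qed.

Lemma wfun_inj k (c : {ffun 'I_k -> mu r}) (s : 'S_k) : injective (wfun c s).
Proof. by case: (wfun_mor c s) => /bij_inj. Qed.

(** A canonical block is chosen in every orbit of blocks. The label of a point consists of the rank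
    of the canonical block of its orbit and of the group element, unique by freeness, carrying that
    block to its own. *)
Lemma adm_fibs P : adm (@nact r n) P ->
  exists k, exists d, exists t, @surjb k t /\ fibs d t = P.
Proof.
case/and3P => partP /forallP stabP /forallP freeP.
have [/eqP coverP trivP P0] := and3P partP.
have stab g J : J \in P -> act g J \in P by move=> h; have /forall_inP := stabP g; apply.
have free g J : J \in P -> act g J = J -> g = 0.
  move=> h e; have /forall_inP/(_ J h) := freeP g.
  by rewrite e eqxx => /eqP.
have inP x : x \in cover P by rewrite coverP inE.
pose B x := pblock P x.
have BP x : B x \in P by exact: pblock_mem.
have xB x : x \in B x by rewrite mem_pblock.
have Bdef J x : J \in P -> x \in J -> B x = J by move=> JP xJ; exact: def_pblock trivP JP xJ.
have Bact g x : B (nact g x) = act g (B x).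
  by apply: Bdef; [exact: stab | rewrite mem_actset nactK].
pose orb J := [pred J' | (J' \in P) && [exists g, act g J == J']].
(* [pick] sees only the orbit, so [canon] is constant on orbits; for [J] in [P] the default is not
   taken, as [J] itself qualifies. *)
pose canon J := odflt J [pick J' in orb J].
have orbE g J : orb (act g J) =1 orb J.
  move=> J' /=; congr (_ && _); apply/existsP/existsP => -[h /eqP e].
    by exists (h + g); rewrite actsetD e.
  by exists (h - g); rewrite -actsetD subrK e.
have canonP J : J \in P -> canon J \in P /\ exists g, act g (canon J) = J.
  move=> JP; rewrite /canon; case: pickP => [J' /andP[J'P /existsP[g /eqP e]]|/(_ J)] /=.
    by split => //; exists (- g); rewrite -e -actsetD addNr actset0.
  by rewrite !inE JP /=; move/negbT/existsPn/(_ 0); rewrite actset0 eqxx.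
have canonE g J : J \in P -> canon (act g J) = canon J.
  move=> JP; rewrite /canon (eq_pick (orbE g J)); case: pickP => //= /(_ J).
  by rewrite !inE JP /=; move/negbT/existsPn/(_ 0); rewrite actset0 eqxx.
pose R := [set canon J | J in P].
pose sR := {K | K \in R}.
pose cR J (JP : J \in P) : sR := Sub (canon J) (imset_f canon JP).
pose gg J := odflt 0 [pick g | act g (canon J) == J].
have ggP J : J \in P -> act (gg J) (canon J) = J.
  move=> JP; rewrite /gg; case: pickP => [g /eqP //|h].
  by have [_ [g e]] := canonP _ JP; have := h g; rewrite e eqxx.
pose k := #|{: sR}|.
pose d := [ffun j => gg (B (0, j))].
pose t : {ffun 'I_n -> 'I_k} := [ffun j => enum_rank (cR _ (BP (0, j)))].
have B0 x : B x = act (x.1 + d x.2) (canon (B (0, x.2))).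
  rewrite actsetD ffunE ggP // -Bact; congr B.
  by case: x => z j; rewrite /nact /= addr0.
have t_eq x y : (t x.2 == t y.2) = (canon (B (0, x.2)) == canon (B (0, y.2))).
  by rewrite !ffunE (inj_eq enum_rank_inj) -val_eqE.
have canonB x : canon (B x) = canon (B (0, x.2)).
  rewrite -(canonE x.1 (B (0, x.2))) // -Bact; congr (canon (B _)).
  by case: x => z j; rewrite /nact /= addr0.
(* The labelling and the block map have the same kernel; freeness recovers the group component. *)
have ker x y : (phi d t x == phi d t y) = (B x == B y).
  rewrite xpair_eqE t_eq; apply/andP/eqP => [[/eqP e1 /eqP e2]|e].
    by rewrite (B0 x) (B0 y) e1 e2.
  have e2 : canon (B (0, x.2)) = canon (B (0, y.2)) by rewrite -!canonB e.
  split; last exact/eqP.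
  move: e; rewrite (B0 x) (B0 y) e2 => e; rewrite -subr_eq0; apply/eqP.
  have [KP _] := canonP _ (BP (0, y.2)).
  apply: (free _ _ (stab (y.1 + d y.2) _ KP)).
  by rewrite -actsetD subrK e.
have st : surjb t.
  apply/forallP => i; case E : (enum_val i) => [K KR].
  have [J JP e] := imsetP KR.
  have [KP _] := canonP _ JP; rewrite -e in KP.
  have /set0Pn [x xK] : K != set0 by apply: contraNneq P0 => <-.
  apply/existsP; exists x.2; rewrite ffunE -(enum_valK i) E (inj_eq enum_rank_inj).
  rewrite -val_eqE /= -canonB (Bdef _ _ KP xK) e.
  by have [_ [g eg]] := canonP _ JP; rewrite -{2}eg canonE // -?e.
exists k, d, t; split => //.
have fB x : fib d t (phi d t x) = B x.
  by apply/setP => y; rewrite inE ker eq_sym eq_pblock.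
apply/setP => J; apply/imsetP/idP => [[y _ ->]|JP].
  by have [x <-] := phi_surj d st y; rewrite fB.
have /set0Pn [x xJ] : J != set0 by apply: contraNneq P0 => <-.
by exists (phi d t x) => //; rewrite fB (Bdef J).
Qed.

(** [W(r,k)] acts simply transitively on the labellings of a partition by [k], and [r.-1.+1] is the
    order of [mu r]. *)
Lemma card_labellings k d (t : {ffun 'I_n -> 'I_k}) : @surjb k t ->
  (\sum_(d' : {ffun 'I_n -> mu r}) \sum_(t' : {ffun 'I_n -> 'I_k} | surjb t')
     (fibs d' t' == fibs d t))%N = (r.-1.+1 ^ k * k`!)%N.
Proof.
move=> st; rewrite pair_big_dep /= -big_mkcondr sum1_card.
pose F (w : {ffun 'I_k -> mu r} * 'S_k) : {ffun 'I_n -> mu r} * {ffun 'I_n -> 'I_k} :=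
  ([ffun j => d j + w.1 (t j)], [ffun j => w.2 (t j)]).
have Finj : injective F.
  move=> [c s] [c' s'] [e1 e2].
  have [] := @wfun_phi_unique k d t c s c' s' st; last by move=> -> ->.
  by move=> x; rewrite -!phi_wfun e1 e2.
have -> : (r.-1.+1 ^ k * k`!)%N = #|[set F w | w : _]|.
  by rewrite card_imset // card_prod card_ffun !card_ord card_Sn.
apply: eq_card => -[d' t']; rewrite [LHS]unfold_in /=.
apply/idP/imsetP => [/andP[st' /eqP e]|[[c s] _ [-> ->]]].
  have [c [s h]] := kernel_wfun st st' (fibs_kernel (esym e)) (fibs_kernel e).
  exists (c, s) => //; rewrite /F /=.
  have [] := @phi_ext k d' t' [ffun j => d j + c (t j)] [ffun j => s (t j)]; last by move=> -> ->.
  by move=> x; rewrite phi_wfun.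
rewrite surjb_comp //=; apply/eqP/kernel_fibs => //; first exact: surjb_comp.
by move=> x y; rewrite !phi_wfun (inj_eq (@wfun_inj _ _ _)).
Qed.

(** A partition has labellings for one [k] only, fixed by its number of blocks, and the factor is
    the inverse of their number. *)
Lemma sum_adm (R : numFieldType) (F : {set {set X}} -> R) :
  \sum_(P | adm (@nact r n) P) F P =
  \sum_(k < n.+1) (r.-1.+1 ^ k * k`!)%N%:R^-1 *
    \sum_(d : {ffun 'I_n -> mu r}) \sum_(t : {ffun 'I_n -> 'I_k} | surjb t) F (fibs d t).
Proof.
transitivity (\sum_(k < n.+1) (r.-1.+1 ^ k * k`!)%N%:R^-1 *
    \sum_(d : {ffun 'I_n -> mu r}) \sum_(t : {ffun 'I_n -> 'I_k} | surjb t)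
    \sum_(P | adm (@nact r n) P) (fibs d t == P)%:R * F P); last first.
  apply: eq_bigr => k _; congr (_ * _); apply: eq_bigr => d _; apply: eq_bigr => t st.
  rewrite (bigD1 (fibs d t)) ?fibs_adm //= eqxx mul1r big1 ?addr0 // => P /andP[_ /negPf].
  by rewrite eq_sym => ->; rewrite mul0r.
transitivity (\sum_(P | adm (@nact r n) P) (\sum_(k < n.+1) (r.-1.+1 ^ k * k`!)%N%:R^-1 *
    (\sum_(d : {ffun 'I_n -> mu r}) \sum_(t : {ffun 'I_n -> 'I_k} | surjb t)
     (fibs d t == P))%N%:R) * F P); last first.
  under eq_bigr do rewrite mulr_suml.
  rewrite exchange_big; apply: eq_bigr => k _ /=.
  under eq_bigr do rewrite -mulrA natr_sum mulr_suml.
  rewrite -mulr_sumr exchange_big /=; congr (_ * _); apply: eq_bigr => d _.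
  under eq_bigr do rewrite natr_sum mulr_suml.
  by rewrite exchange_big.
apply: eq_bigr => P /adm_fibs [k [d [t [st <-]]]].
have kn : (k < n.+1)%N by rewrite ltnS (surjb_leq st).
rewrite (bigD1 (Ordinal kn)) //= card_labellings // mulVf; last first.
  by rewrite pnatr_eq0 -lt0n muln_gt0 expn_gt0 fact_gt0.
rewrite big1 ?addr0 ?mul1r // => i ne; rewrite big1 ?mulr0 // => d' _.
apply: big1 => t' st'; apply/eqP; rewrite eqb0; apply: contraNneq ne => e.
have := card_fibs d st; rewrite -e (card_fibs d' st') => /eqP.
by rewrite eqn_pmul2l // => /eqP ie; apply/eqP/val_inj.
Qed.

(** The identity [phi o w = w' o phi], tested at the points (0, j), which suffices by
    equivariance. *)
Definition covers k (c : {ffun 'I_n -> mu r}) (s : 'S_n) d (t : {ffun 'I_n -> 'I_k})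
    (c' : {ffun 'I_k -> mu r}) (s' : 'S_k) : bool :=
  [forall j, (t (s j) == s' (t j)) && (c j + d (s j) == d j + c' (t j))].

Lemma coversP k (c : {ffun 'I_n -> mu r}) (s : 'S_n) d (t : {ffun 'I_n -> 'I_k})
    (c' : {ffun 'I_k -> mu r}) (s' : 'S_k) :
  reflect (forall x, phi d t (wfun c s x) = wfun c' s' (phi d t x)) (covers c s d t c' s').
Proof.
apply: (iffP forallP) => [h [z j]|h j].
  by case/andP: (h j) => /eqP e1 /eqP e2; rewrite /phi /wfun /= -addrA e1 e2 addrA.
by have := h (0, j); rewrite /phi /wfun /= !add0r => /eqP; rewrite xpair_eqE andbC.
Qed.

Lemma fimg_fib k (c : {ffun 'I_n -> mu r}) (s : 'S_n) d (t : {ffun 'I_n -> 'I_k}) c' s' y :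
  @covers k (c : {ffun 'I_n -> mu r}) (s : 'S_n) d (t : {ffun 'I_n -> 'I_k}) c' s' ->
  wfun c s @: fib d t y = fib d t (wfun c' s' y).
Proof.
move=> /coversP h; case: (wfun_mor c s) => -[w wK Kw] _.
apply/setP => x; apply/imsetP/idP => [[u]|]; rewrite inE.
  by move=> /eqP <- ->; rewrite inE h.
move=> /eqP e; exists (w x); rewrite ?Kw // inE.
by apply/eqP/(@wfun_inj _ c' s'); rewrite -h Kw.
Qed.

Lemma fimg_fibs k (c : {ffun 'I_n -> mu r}) (s : 'S_n) d (t : {ffun 'I_n -> 'I_k}) c' s' :
  @covers k (c : {ffun 'I_n -> mu r}) (s : 'S_n) d (t : {ffun 'I_n -> 'I_k}) c' s' ->
  fibs d t = fimg (wfun c s) (fibs d t).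
Proof.
move=> h; case: (wfun_mor c' s') => -[w wK Kw] _.
apply/setP => J; apply/imsetP/imsetP => [[y _ ->]|[_ /imsetP[y _ ->] ->]].
  by exists (fib d t (w y)); rewrite ?imset_f // (fimg_fib _ h) Kw.
by exists (wfun c' s' y); rewrite ?(fimg_fib _ h).
Qed.

Lemma phi_comp_wfun k (c : {ffun 'I_n -> mu r}) (s : 'S_n) d (t : {ffun 'I_n -> 'I_k}) x :
  phi [ffun j => c j + d (s j)] [ffun j => t (s j)] x = @phi k d t (wfun c s x).
Proof. by rewrite /phi /wfun !ffunE /= addrA. Qed.

(** When [w] preserves the partition, [phi] and [phi o w] are surjections with the same kernel. *)
Lemma fimg_covers k (c : {ffun 'I_n -> mu r}) (s : 'S_n) d (t : {ffun 'I_n -> 'I_k}) :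
  @surjb k t -> fibs d t = fimg (wfun c s) (fibs d t) ->
  exists c' s', covers c s d t c' s'.
Proof.
move=> st e.
have ker x y : phi d t x = phi d t y <-> phi d t (wfun c s x) = phi d t (wfun c s y).
  have /imsetP[y1 _ e1] : wfun c s @: fib d t (phi d t x) \in fibs d t.
    by rewrite e; apply: imset_f; exact: imset_f.
  have xi : wfun c s x \in fib d t y1 by rewrite -e1 imset_f // inE.
  have := mem_imset (fib d t (phi d t x)) y (@wfun_inj _ c s).
  rewrite e1 !inE; move: xi; rewrite inE => /eqP -> H.
  by split => /eqP h; apply/eqP; move: h; rewrite eq_sym => h; [rewrite eq_sym H|rewrite eq_sym -H].
have st' : surjb [ffun j => t (s j)].
  apply/forallP => i; have /forallP/(_ i)/existsP[j /eqP ej] := st.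
  by apply/existsP; exists (s^-1%g j); rewrite ffunE permKV ej.
have [||c' [s' h]] := @kernel_wfun k d t [ffun j => c j + d (s j)] [ffun j => t (s j)] st st'.
- by move=> x y; rewrite !phi_comp_wfun => /(ker x y).
- by move=> x y; rewrite !phi_comp_wfun => /(proj2 (ker x y)).
by exists c', s'; apply/coversP => x; rewrite -h phi_comp_wfun.
Qed.

Lemma covers_unique k (c : {ffun 'I_n -> mu r}) (s : 'S_n) d (t : {ffun 'I_n -> 'I_k}) c1 s1 c2 s2 :
  @surjb k t ->
  covers c s d t c1 s1 -> covers c s d t c2 s2 -> c1 = c2 /\ s1 = s2.
Proof.
move=> st /coversP h1 /coversP h2.
by apply: (wfun_phi_unique (d := d) st) => x; rewrite -h1 h2.
Qed.

End Labelling.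

(** * Covers of a permutation *)

Section Cycles.
Variables (k : nat) (s' : 'S_k).

Definition cycleT := {O : {set 'I_k} | O \in porbits s'}.
Implicit Types O : cycleT.

Lemma cycleT_nonempty O : exists i, i \in val O.
Proof.
by case/imsetP: (valP O) => i _ e; exists i; rewrite e porbit_id.
Qed.
Definition base O : 'I_k := xchoose (cycleT_nonempty O).
(** The length of the cycle minus one, so that ['I_(len O).+1] has an [ord0]. *)
Definition len O : nat := #|val O|.-1.

Lemma val_cycleT O : val O = porbit s' (base O).
Proof.
by apply/esym/eqP; rewrite -(mem_porbits_eq _ (valP O)) (xchooseP (cycleT_nonempty O)).
Qed.
Lemma lenE O : (len O).+1 = #|val O|.
Proof. by rewrite prednK //; case/andP: (card_porbit_mem (valP O)). Qed.

(** For [a] at most [len O], the pairs [(O, a)] serve as coordinates on ['I_k]. *)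
Definition cyc_iter O (a : nat) : 'I_k := iter a s' (base O).

Lemma cyc_iter_wrap O : cyc_iter O (len O).+1 = base O.
Proof. by rewrite /cyc_iter lenE val_cycleT iter_porbit. Qed.

Lemma cyc_iter_mem O a : cyc_iter O a \in val O.
Proof. by rewrite val_cycleT /cyc_iter -permX mem_porbit. Qed.

Lemma cyc_iter_inj O a O' a' : (a < (len O).+1)%N -> (a' < (len O').+1)%N ->
  cyc_iter O a = cyc_iter O' a' -> O = O' /\ a = a'.
Proof.
move=> ha ha' e.
have eO : O = O'.
  apply/val_inj; have := cyc_iter_mem O' a'; rewrite -e => m'.
  have := cyc_iter_mem O a; rewrite (mem_porbits_eq _ (valP O)) => /eqP <-.
  by apply/eqP; rewrite -(mem_porbits_eq _ (valP O')).
split => //; subst O'; move: ha ha' e; rewrite lenE val_cycleT => ha ha' e.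
apply/eqP; rewrite -(nth_uniq (base O) _ _ (uniq_traject_porbit s' (base O))) ?size_traject //.
by rewrite !nth_traject //; apply/eqP.
Qed.

Lemma cyc_iter_surj i : exists O, exists2 a, (a < (len O).+1)%N & cyc_iter O a = i.
Proof.
have iP : porbit s' i \in porbits s' by exact: imset_f.
pose O : cycleT := Sub (porbit s' i) iP; exists O.
have : i \in val O by rewrite SubK porbit_id.
rewrite val_cycleT porbit_traject => /trajectP[a ha e]; exists a; rewrite ?e //.
by rewrite lenE val_cycleT.
Qed.

(** * The standard cover with given monodromy, and its frames *)

Section Model.
Variables (n : nat) (nu : cycleT -> nat).

(** The standard cover of {1..k} with fibre {1..nu_O} over the points of O;
    [step] goes around O and acts by [sg O] on completing a turn. *)
Definition model := {O : cycleT & ('I_(len O).+1 * 'I_(nu O))%type}.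
Definition pt O (a : 'I_(len O).+1) (u : 'I_(nu O)) : model :=
  Tagged (fun O => ('I_(len O).+1 * 'I_(nu O))%type) (a, u).
Definition proj (p : model) : 'I_k := cyc_iter (tag p) (tagged p).1.
Definition step (sg : {dffun forall O, 'S_(nu O)}) (p : model) : model :=
  pt (ordS (tagged p).1)
    (if (tagged p).1 == ord_max then sg (tag p) (tagged p).2 else (tagged p).2).

Lemma card_model : #|{: model}| = (\sum_O (len O).+1 * nu O)%N.
Proof.
by rewrite card_tagged sumnE big_map big_enum; apply: eq_bigr => O _; rewrite card_prod !card_ord.
Qed.

Lemma proj_inj O a u O' a' u' : proj (@pt O a u) = proj (@pt O' a' u') ->
  Tagged (fun O => 'I_(len O).+1) a = Tagged (fun O => 'I_(len O).+1) a'.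
Proof.
rewrite /proj /= => /cyc_iter_inj [] // e; subst O' => /val_inj -> //.
Qed.

Lemma proj_step sg p : proj (step sg p) = s' (proj p).
Proof.
case: p => O [a u]; rewrite /proj /step /=.
have := ltn_ord a; rewrite ltnS leq_eqVlt => /orP[/eqP e|h].
  (* At the last position [ordS] returns to 0, just as [s'] returns to the base point. *)
  by rewrite e modnn /= -[LHS](cyc_iter_wrap O) /cyc_iter.
by rewrite modn_small.
Qed.

Lemma step_inj sg : injective (step sg).
Proof.
move=> [O [a u]] [O' [a' u']] e.
have : proj (pt a u) = proj (pt a' u').
  by apply: (@perm_inj _ s'); rewrite -!(proj_step sg) e.
move=> /proj_inj h; have eO : O = O' := congr1 tag h; subst O'.
have {}h : a = a' by move/eqP: h; rewrite eq_Tagged => /eqP.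
subst a'; suff -> : u = u' by [].
have : (step sg (existT _ O (a, u))) == (step sg (existT _ O (a, u'))) by apply/eqP.
rewrite eq_Tagged /= xpair_eqE => /andP[_]; case: ifP => _ /eqP //.
exact: perm_inj.
Qed.

(** [H] identifies the standard cover of monodromy [sg] with the cover [t] and its lift [s];
    bijectivity of [H] is a separate condition. *)
Definition frames (t : {ffun 'I_n -> 'I_k}) (s : 'S_n)
    (sg : {dffun forall O, 'S_(nu O)}) (H : {ffun model -> 'I_n}) : bool :=
  [forall p, (t (H p) == proj p) && (s (H p) == H (step sg p))].

Definition lifts (t : {ffun 'I_n -> 'I_k}) (s : 'S_n) := [forall j, t (s j) == s' (t j)].

Lemma frames_exists sg (H : {ffun model -> 'I_n}) : injectiveb H -> #|{: model}| = n ->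
  exists t s, frames t s sg H.
Proof.
move=> /injectiveP iH cn.
have [|H' HK KH] := inj_card_bij iH; first by rewrite card_ord cn.
have si : injective (fun j => H (step sg (H' j))).
  by move=> i j /iH /step_inj /(can_inj KH).
exists [ffun j => proj (H' j)], (perm si).
by apply/forallP => p; rewrite ffunE permE HK !eqxx.
Qed.

Section Frames.
Variables (t : {ffun 'I_n -> 'I_k}) (s : 'S_n).
Variables (sg : {dffun forall O, 'S_(nu O)}) (H : {ffun model -> 'I_n}).
Hypothesis fr : frames t s sg H.

Lemma frames_proj p : t (H p) = proj p.
Proof. by have /forallP/(_ p)/andP[/eqP] := fr. Qed.
Lemma frames_step p : s (H p) = H (step sg p).
Proof. by have /forallP/(_ p)/andP[_ /eqP] := fr. Qed.

Lemma frames_iter O a (ha : (a < (len O).+1)%N) u :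
  H (pt (Ordinal ha) u) = iter a s (H (pt (ord0 : 'I_(len O).+1) u)).
Proof.
elim: a ha => [|a IH] ha; first by congr (H (pt _ _)); apply/val_inj.
have ha' := ltnW ha; rewrite iterS -(IH ha') frames_step; congr (H _).
rewrite /step /= ifF; last by apply/eqP => /(congr1 val) /= e; rewrite e ltnn in ha.
by congr (pt _ _); apply/val_inj; rewrite /= modn_small.
Qed.

(** A full turn along [s] over the base point is [sg O], so [s] and an injective [H] determine
    [sg]. *)
Lemma frames_last O u : H (pt (ord0 : 'I_(len O).+1) (sg O u)) =
  iter (len O).+1 s (H (pt (ord0 : 'I_(len O).+1) u)).
Proof.
rewrite iterS -(frames_iter (ltnSn _)) frames_step; congr (H _).
rewrite /step /= ifT; last by apply/eqP/val_inj.
by congr (pt _ _); apply/val_inj; rewrite /= modnn.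
Qed.
End Frames.

Section Bijective.
Variables (t : {ffun 'I_n -> 'I_k}) (s : 'S_n).
Variables (sg : {dffun forall O, 'S_(nu O)}) (H : {ffun model -> 'I_n}).
Hypotheses (fr : frames t s sg H) (iH : injectiveb H) (cn : #|{: model}| = n).

Lemma frames_surj j : exists p, H p = j.
Proof.
have [|H' HK KH] := inj_card_bij (injectiveP _ iH); first by rewrite card_ord cn.
by exists (H' j).
Qed.

Lemma frames_lifts : lifts t s.
Proof.
apply/forallP => j; have [p <-] := frames_surj j.
by rewrite (frames_step fr) !(frames_proj fr) proj_step.
Qed.

Lemma frames_unique t1 s1 : frames t1 s1 sg H -> t1 = t /\ s1 = s.
Proof.
move=> fr1; split; [apply/ffunP|apply/permP] => j; have [p <-] := frames_surj j.
  by rewrite (frames_proj fr) (frames_proj fr1).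
by rewrite (frames_step fr) (frames_step fr1).
Qed.

Lemma frames_fibre O : #|[set j | t j == base O]| = nu O.
Proof.
pose h u := H (pt (ord0 : 'I_(len O).+1) u).
have ih : injective h.
  move=> u v /(injectiveP _ iH) /eqP; rewrite eq_Tagged /= xpair_eqE eqxx => /eqP //.
rewrite -[RHS]card_ord -(card_imset _ ih); apply: eq_card => j; rewrite !inE.
apply/eqP/imsetP => [|[u _ ->]]; last by rewrite (frames_proj fr).
have [[O' [a u]] <-] := frames_surj j; rewrite (frames_proj fr) => e.
(* For positive [nu O] there is a point over [base O] to compare with by [proj_inj]; otherwise [u]
   cannot exist. *)
case: (posnP (nu O)) => [O0|Opos]; last first.
  have /proj_inj f : proj (pt a u) = proj (pt (ord0 : 'I_(len O).+1) (Ordinal Opos)) := e.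
  have eO : O' = O := congr1 tag f; subst O'.
  have {}f : a = ord0 by move/eqP: f; rewrite eq_Tagged => /eqP.
  by exists u => //; rewrite f.
have [] := @cyc_iter_inj O' a O 0 (ltn_ord a) isT e => eO _; subst O'.
by have up := leq_ltn_trans (leq0n _) (ltn_ord u); rewrite O0 in up.
Qed.
End Bijective.

(** * Counting the frames of a cover *)

Section Count.
Variables (t : {ffun 'I_n -> 'I_k}) (s : 'S_n).
Hypothesis ov : lifts t s.
Hypothesis nuE : forall O, #|[set j | t j == base O]| = nu O.

(** Numberings of the base fibres: by [nuE], an injection into such a fibre is a bijection. *)
Definition basefr := [set h : {dffun forall O, {ffun 'I_(nu O) -> 'I_n}} |
  [forall O, injectiveb (h O) && [forall u, t (h O u) == base O]]].

Lemma card_basefr : #|basefr| = (\prod_O (nu O)`!)%N.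
Proof.
transitivity #|(family (fun O => mem [set f in ffun_on [pred j | t j == base O] | injectiveb f])
   : pred {dffun forall O, {ffun 'I_(nu O) -> 'I_n}})|.
  apply: eq_card => h; rewrite inE; apply/forallP/familyP => H O; have := H O.
    by case/andP => h1 /forallP h2; rewrite !inE h1 andbT; apply/ffun_onP.
  by rewrite !inE => /andP[/ffun_onP h2 ->]; apply/forallP => u; have := h2 u.
rewrite card_family foldrE big_image; apply: eq_bigr => O _ /=.
rewrite -ffactnn.
transitivity #|[set f : {ffun 'I_(nu O) -> 'I_n} in
  ffun_on [pred j | t j == base O] | injectiveb f]|; first by apply: eq_card => f; rewrite !inE.
rewrite card_inj_ffuns_on; rewrite card_ord; congr (_ ^_ _)%N; rewrite -(nuE O).
by apply: eq_card => j; rewrite !inE.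
Qed.

Lemma lifts_iter a j : t (iter a s j) = iter a s' (t j).
Proof. by elim: a => //= a <-; apply/eqP; have /forallP := ov. Qed.

Section Build.
Variable h : {dffun forall O, {ffun 'I_(nu O) -> 'I_n}}.
Hypothesis hP : h \in basefr.

Lemma basefr_inj O : injective (h O).
Proof. by move: hP; rewrite inE => /forallP/(_ O)/andP[/injectiveP]. Qed.
Lemma basefr_fibre O u : t (h O u) = base O.
Proof. by move: hP; rewrite inE => /forallP/(_ O)/andP[_ /forallP/(_ u)/eqP]. Qed.
Lemma basefr_onto O j : t j = base O -> exists u, h O u == j.
Proof.
move=> tj; have : j \in [set h O u | u : 'I_(nu O)].
  suff -> : [set h O u | u : 'I_(nu O)] = [set j | t j == base O] by rewrite inE tj.
  apply/eqP; rewrite eqEcard (card_imset _ (@basefr_inj O)) card_ord nuE leqnn andbT.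
  by apply/subsetP => _ /imsetP[u _ ->]; rewrite inE basefr_fibre.
by case/imsetP => u _ ->; exists u.
Qed.

(** The numbering of a base fibre is carried to the [a]-th point of the cycle by [a] applications of
    [s]. *)
Definition bframe : {ffun model -> 'I_n} :=
  [ffun p : model => iter (tagged p).1 s (h (tag p) (tagged p).2)].

Lemma t_bframe p : t (bframe p) = proj p.
Proof. by rewrite ffunE lifts_iter basefr_fibre. Qed.

Lemma iter_perm_inj (T : finType) (f : {perm T}) a : injective (iter a f).
Proof. by move=> x y; rewrite -!permX => /perm_inj. Qed.

Lemma bframe_inj : injectiveb bframe.
Proof.
apply/injectiveP => -[O [a u]] [O' [a' u']] e.
have : proj (pt a u) = proj (pt a' u') by rewrite -!t_bframe e.
move=> /proj_inj f; have eO : O = O' := congr1 tag f; subst O'.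
have {}f : a = a' by move/eqP: f; rewrite eq_Tagged => /eqP.
by subst a'; move: e; rewrite !ffunE /= => /iter_perm_inj /basefr_inj ->.
Qed.

Lemma card_model_bframe : #|{: model}| = n.
Proof.
apply/eqP; rewrite eqn_leq; apply/andP; split.
  by rewrite -[n]card_ord; exact: leq_card (injectiveP _ bframe_inj).
rewrite -[n]card_ord -(_ : #|codom bframe| = #|'I_n|) ?leq_image_card //.
apply: eq_card => j; rewrite [RHS]inE; apply/codomP.
(* If [t j] is the [a]-th point of [O], moving [j] back by [a] steps of [s] brings it to the base
   fibre. *)
have [O [a ha e]] := cyc_iter_surj (t j).
have [|u /eqP hu] := @basefr_onto O (iter a (s^-1)%g j).
  apply: (@iter_perm_inj _ s' a); rewrite -lifts_iter -!permX expgVn permKV.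
  by rewrite -e /cyc_iter permX.
exists (pt (Ordinal ha) u); rewrite ffunE /= hu -!permX expgVn permKV //.
Qed.

Lemma bframe_frames : exists sg, frames t s sg bframe.
Proof.
(* A full turn of [s] maps the base fibre to itself; this return map is the monodromy. *)
have ex O u : {v | h O v == iter (len O).+1 s (h O u)}.
  apply: sigW; apply: basefr_onto; rewrite lifts_iter basefr_fibre; exact: cyc_iter_wrap.
have inj O : injective (fun u => sval (ex O u)).
  move=> u v e; have := eqP (svalP (ex O u)); rewrite e (eqP (svalP (ex O v))).
  by move=> /iter_perm_inj /basefr_inj.
exists [ffun O => perm (@inj O)]; apply/forallP => p.
rewrite t_bframe eqxx /=; case: p => O [a u]; rewrite !ffunE /step /=.
case: (a =P ord_max) => [->|ne] /=.
  by rewrite modnn /= ffunE permE (eqP (svalP (ex O u))).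
rewrite modn_small ?iterS // ltn_neqAle ltn_ord andbT eqSS.
by apply/eqP => e; apply: ne; apply/val_inj.
Qed.
End Build.

(** Some numbering of the base fibres exists, their number being a product of factorials. *)
Lemma card_model_lifts : #|{: model}| = n.
Proof.
have : (0 < #|basefr|)%N by rewrite card_basefr prodn_gt0 // => O; exact: fact_gt0.
by case/card_gt0P => h /card_model_bframe.
Qed.

(** A frame is determined by its restriction to the fibres over the points
    [base O], which can be any bijections. *)
Lemma card_frames : #|[set sH : {dffun forall O, 'S_(nu O)} * {ffun model -> 'I_n} |
   injectiveb sH.2 && frames t s sH.1 sH.2]| = (\prod_O (nu O)`!)%N.
Proof.
pose Phi (sH : {dffun forall O, 'S_(nu O)} * {ffun model -> 'I_n}) :
    {dffun forall O, {ffun 'I_(nu O) -> 'I_n}} :=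
  [ffun O => [ffun u => sH.2 (pt (ord0 : 'I_(len O).+1) u)]].
rewrite -card_basefr -(@card_in_imset _ _ Phi) => [|[g H] [g' H']]; last first.
  rewrite !inE /= => /andP[iH fr] /andP[iH' fr'] e.
  have E0 O u : H (pt (ord0 : 'I_(len O).+1) u) = H' (pt (ord0 : 'I_(len O).+1) u).
    have := congr1 (fun h : {dffun forall O, {ffun 'I_(nu O) -> 'I_n}} => h O u) e.
    by rewrite !ffunE.
  have EH : H = H'.
    apply/ffunP => -[O [[a ha] u]].
    by rewrite (frames_iter fr) (frames_iter fr') E0.
  subst H'; congr (_, _); apply/ffunP => O; apply/permP => u.
  have : H (pt (ord0 : 'I_(len O).+1) (g O u)) = H (pt (ord0 : 'I_(len O).+1) (g' O u)).
    by rewrite (frames_last fr) (frames_last fr').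
  by move=> /(injectiveP _ iH) /eqP; rewrite eq_Tagged /= xpair_eqE eqxx => /eqP.
apply/eq_card => h; apply/imsetP/idP => [[[g H]]|hP].
  rewrite inE /= => /andP[iH fr] ->; rewrite inE; apply/forallP => O.
  apply/andP; split; last first.
    by apply/forallP => u; rewrite !ffunE (frames_proj fr).
  apply/injectiveP => u v; rewrite !ffunE => /(injectiveP _ iH) /eqP.
  by rewrite eq_Tagged /= xpair_eqE eqxx => /eqP.
have [sg fr] := bframe_frames hP.
exists (sg, bframe h); first by rewrite inE /= bframe_inj.
by apply/ffunP => O; apply/ffunP => u; rewrite !ffunE.
Qed.

End Count.

(** Double count of the quadruples [(t, s, sg, H)]: a pair [(t, s)] with fibre sizes [nu] has
    [\prod_O (nu O)!] frames, while each [sg] with each of the [n!] bijections [H] comes from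
    exactly one [(t, s)]. *)
Lemma sum_frames (S : comNzRingType) (F : {ffun 'I_n -> 'I_k} -> 'S_n -> S)
    (G : {dffun forall O, 'S_(nu O)} -> S) :
  #|{: model}| = n ->
  (forall t s sg (H : {ffun model -> 'I_n}), injectiveb H -> frames t s sg H -> F t s = G sg) ->
  (\sum_t \sum_(s | lifts t s && [forall O, #|[set j | t j == base O]| == nu O]) F t s)
     *+ (\prod_O (nu O)`!) = (\sum_sg G sg) *+ n`!.
Proof.
move=> cn FG.
pose Z t s := [set sH : {dffun forall O, 'S_(nu O)} * {ffun model -> 'I_n} |
   injectiveb sH.2 && frames t s sH.1 sH.2].
transitivity (\sum_t \sum_s \sum_(sH in Z t s) F t s).
  rewrite -sumrMnl; apply: eq_bigr => t _; rewrite -sumrMnl big_mkcond.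
  apply: eq_bigr => s _; rewrite sumr_const.
  case: ifP => [/andP[ov /forallP nuE]|/negbT h].
    by rewrite card_frames // => O; apply/eqP.
  rewrite (_ : Z t s = set0) ?cards0 //; apply/setP => -[g H]; rewrite !inE /=.
  apply: contraNF h => /andP[iH fr]; rewrite (frames_lifts fr iH cn).
  by apply/forallP => O; rewrite (frames_fibre fr iH cn).
transitivity (\sum_(sH : {dffun forall O, 'S_(nu O)} * {ffun model -> 'I_n} | injectiveb sH.2)
   \sum_(ts : {ffun 'I_n -> 'I_k} * 'S_n | frames ts.1 ts.2 sH.1 sH.2) F ts.1 ts.2).
  rewrite pair_big /=.
  under eq_bigr => ts _ do under eq_bigl do rewrite inE.
  rewrite (exchange_big_dep (fun sH : {dffun forall O, 'S_(nu O)} * {ffun model -> 'I_n} =>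
    injectiveb sH.2)) /=; last by move=> ts sH _ /andP[].
  apply: eq_bigr => sH iH; apply: eq_bigl => ts; by rewrite iH.
transitivity (\sum_(sH : {dffun forall O, 'S_(nu O)} * {ffun model -> 'I_n} | injectiveb sH.2)
   G sH.1).
  apply: eq_bigr => -[g H] /= iH; have [t [s fr]] := frames_exists g iH cn.
  rewrite (bigD1 (t, s)) //= (FG _ _ _ _ iH fr) big1 ?addr0 // => -[t1 s1] /= /andP[fr1].
  by case: (frames_unique fr iH cn fr1) => -> ->; rewrite eqxx.
rewrite -(pair_big xpredT (fun H : {ffun model -> 'I_n} => injectiveb H) (fun g _ => G g)) /=.
rewrite -sumrMnl; apply: eq_bigr => g _; rewrite sumr_const; congr (_ *+ _).
have := card_inj_ffuns model 'I_n; rewrite cn card_ord ffactnn => <-.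
by apply: eq_card => H; rewrite inE.
Qed.

End Model.

Local Notation natf nu := (fun O => nat_of_ord (nu O)).

(** The pairs [(t, s)] are sorted by their fibre sizes. Division may be impossible in [S], so the
    quotient of factorials is formed in [C] and mapped by [io]. *)
Lemma sum_lifts (C : numClosedFieldType) (S : comNzRingType) (io : {rmorphism C -> S}) n
    (F : {ffun 'I_n -> 'I_k} -> 'S_n -> S)
    (G : forall nu : cycleT -> nat, {dffun forall O, 'S_(nu O)} -> S) :
  (forall (nu : cycleT -> nat) t s sg (H : {ffun model nu -> 'I_n}), #|{: model nu}| = n ->
     injectiveb H -> frames t s sg H -> (forall O, 0 < nu O)%N -> F t s = G nu sg) ->
  \sum_(t | surjb t) \sum_(s | lifts t s) F t s =
  \sum_(nu : {ffun cycleT -> 'I_n.+1} |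
        ((\sum_O (len O).+1 * nu O)%N == n) && [forall O, (0 < nu O)%N])
    io (n`!%:R * (\prod_O (nu O)`!%:R^-1)) * \sum_sg G (natf nu) sg.
Proof.
move=> FG.
pose nuof (t : {ffun 'I_n -> 'I_k}) : {ffun cycleT -> 'I_n.+1} :=
  [ffun O => inord #|[set j | t j == base O]|].
have nuofE t O : nuof t O = #|[set j | t j == base O]| :> nat.
  by rewrite ffunE inordK // ltnS -[X in (_ <= X)%N](card_ord n) max_card.
rewrite pair_big_dep /=.
rewrite (partition_big (fun ts : {ffun 'I_n -> 'I_k} * 'S_n => nuof ts.1)
  (fun nu => ((\sum_O (len O).+1 * nu O)%N == n) && [forall O, (0 < nu O)%N])) /=; last first.
  move=> [t s] /= /andP[st ov]; apply/andP; split.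
    by rewrite -(card_model (natf (nuof t))) (card_model_lifts ov) // => O; exact/esym/nuofE.
  apply/forallP => O; rewrite nuofE card_gt0; apply/set0Pn.
  by have /forallP/(_ (base O))/existsP[j tj] := st; exists j; rewrite inE.
apply: eq_bigr => nu /andP[/eqP sn /forallP npos].
have cn : #|{: model (natf nu)}| = n by rewrite card_model.
transitivity (\sum_(t : {ffun 'I_n -> 'I_k})
  \sum_(s | lifts t s && [forall O, #|[set j | t j == base O]| == nu O]) F t s).
  rewrite pair_big_dep /=; apply: eq_bigl => -[t s] /=.
  have -> : (nuof t == nu) = [forall O, #|[set j | t j == base O]| == nu O].
    apply/eqP/forallP => [<- O|h]; first by rewrite nuofE.
    by apply/ffunP => O; apply/val_inj/eqP; rewrite /= nuofE.
  rewrite andbAC andbC; case: (boolP (lifts t s)) => ov; rewrite ?andbT ?andbF //=.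
  (* Nonempty fibres over the base points already give surjectivity: transport along [s] reaches the
     other points. *)
  apply: andb_idl => /forallP h; apply/forallP => i.
  have [O [a _ <-]] := cyc_iter_surj i.
  have : (0 < #|[set j | t j == base O]|)%N by rewrite (eqP (h O)).
  case/card_gt0P => j; rewrite inE => /eqP tj.
  by apply/existsP; exists (iter a s j); rewrite (lifts_iter ov) tj.
have prod_neq0 : \prod_O (nu O)`!%:R != 0 :> C.
  by apply/prodf_neq0 => O _; rewrite pnatr_eq0 -lt0n fact_gt0.
have := @sum_frames n (natf nu) S F (G (natf nu)) cn
  (fun t s sg H iH fr => FG _ _ _ _ _ cn iH fr npos).
rewrite -[X in X = _ -> _]mulr_natr -[X in _ = X -> _]mulr_natr => e.
rewrite prodfV rmorphM rmorph_nat -mulrA mulrC -mulrA -e.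
rewrite mulrCA -(rmorph_nat io) natr_prod -rmorphM mulVf // rmorph1.
by rewrite mulr1.
Qed.
End Cycles.

Lemma inj_surj_bij (T T' : finType) (f : T -> T') :
  injective f -> (forall y, exists x, f x = y) -> bijective f.
Proof.
move=> fi fs; apply: inj_card_bij => //.
rewrite -(_ : #|codom f| = #|T'|) ?leq_image_card //.
by apply: eq_card => y; rewrite inE; apply/codomP; have [x <-] := fs y; exists x.
Qed.

Lemma porbit_iter (T : finType) (s : {perm T}) a x : porbit s (iter a s x) = porbit s x.
Proof. by apply/eqP; rewrite eq_porbit_mem -permX mem_porbit. Qed.

Lemma porbit_stable (T : finType) (s : {perm T}) Q i :
  Q \in porbits s -> (s i \in Q) = (i \in Q).
Proof.
by move=> hQ; rewrite !(mem_porbits_eq _ hQ) (porbit_iter s 1 i).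
Qed.

Lemma val_cyc_iter k (s' : 'S_k) (O : cycleT s') :
  val O = [set cyc_iter O a | a : 'I_(len O).+1].
Proof.
apply/setP => i; apply/idP/imsetP => [|[a _ ->]]; last exact: cyc_iter_mem.
rewrite val_cycleT porbit_traject => /trajectP[a ha ->].
by rewrite -val_cycleT -lenE in ha; exists (Ordinal ha).
Qed.

(** * Cycle type of a framed permutation *)

Section WeightOfFrames.
Variables (r k : nat) (s' : 'S_k) (n : nat) (nu : cycleT s' -> nat).
Variables (t : {ffun 'I_n -> 'I_k}) (s : 'S_n).
Variables (sg : {dffun forall O, 'S_(nu O)}) (H : {ffun model nu -> 'I_n}).
Hypotheses (fr : frames t s sg H) (iH : injectiveb H) (cn : #|{: model nu}| = n).

(** The set swept out by [Q] in a turn around [O]; when [Q] is a cycle of [sg O], it is a cycle of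
    [s]. *)
Definition cyc (O : cycleT s') (Q : {set 'I_(nu O)}) : {set 'I_n} :=
  [set H (pt z.1 z.2) | z in setX [set: 'I_(len O).+1] Q].

Lemma pt_inj O (a a' : 'I_(len O).+1) (u u' : 'I_(nu O)) :
  H (pt a u) = H (pt a' u') -> a = a' /\ u = u'.
Proof.
move=> /(injectiveP _ iH) /eqP; rewrite eq_Tagged /= xpair_eqE => /andP[/eqP -> /eqP ->].
by [].
Qed.

Lemma mem_cyc O (Q : {set 'I_(nu O)}) (a : 'I_(len O).+1) u :
  (H (pt a u) \in cyc Q) = (u \in Q).
Proof.
apply/imsetP/idP => [[[a' u'] /=]|uQ]; last by exists (a, u) => //; rewrite !inE.
by rewrite !inE /= => uQ /pt_inj [_ ->].
Qed.

(** A step along [s] moves on around [O], applying [sg O] only when a turn closes, so it stays in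
    [cyc]; conversely full turns realise the powers of [sg O]. *)
Lemma porbit_frames O (a : 'I_(len O).+1) (u : 'I_(nu O)) :
  porbit s (H (pt a u)) = cyc (porbit (sg O) u).
Proof.
have E0 (b : 'I_(len O).+1) v : porbit s (H (pt b v)) = porbit s (H (pt (ord0 : 'I_(len O).+1) v)).
  by case: b => b hb; rewrite (frames_iter fr) porbit_iter.
have E1 v i : porbit s (H (pt (ord0 : 'I_(len O).+1) (((sg O) ^+ i)%g v))) =
    porbit s (H (pt (ord0 : 'I_(len O).+1) v)).
  elim: i => [|i IH]; first by rewrite expg0 perm1.
  by rewrite expgSr permM (frames_last fr) porbit_iter IH.
apply/setP => y; apply/idP/idP => [/porbitP[i ->]|].
  elim: i => [|i IH]; first by rewrite expg0 perm1 mem_cyc porbit_id.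
  rewrite expgSr permM; case/imsetP: IH => -[b v] /=; rewrite !inE /= => hv ->.
  rewrite (frames_step fr) mem_cyc /=; case: ifP => // _.
  by rewrite (porbit_stable _ (imset_f _ _)).
case/imsetP => -[b v] /=; rewrite !inE /= => /porbitP[i ->] ->.
by rewrite -eq_porbit_mem E0 E1 -(E0 a).
Qed.

Lemma card_cyc O (Q : {set 'I_(nu O)}) : #|cyc Q| = ((len O).+1 * #|Q|)%N.
Proof.
rewrite card_imset ?cardsX ?cardsT ?card_ord // => -[a u] [a' u'] /= /pt_inj [-> ->] //.
Qed.

Lemma cyc_inj O (Q : {set 'I_(nu O)}) O' (Q' : {set 'I_(nu O')}) :
  Q != set0 -> cyc Q = cyc Q' ->
  Tagged (fun O => {set 'I_(nu O)}) Q = Tagged (fun O => {set 'I_(nu O)}) Q'.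
Proof.
case/set0Pn => u uQ e.
have : H (pt (ord0 : 'I_(len O).+1) u) \in cyc Q' by rewrite -e mem_cyc.
case/imsetP => -[a' u'] _ /= /(injectiveP _ iH) /(congr1 tag) /= eO; subst O'.
congr (Tagged _ _); apply/setP => v.
by rewrite -(mem_cyc Q ord0 v) e mem_cyc.
Qed.

Lemma porbits_frames : porbits s =
  [set cyc (tagged p) | p : {O : cycleT s' & {set 'I_(nu O)}} in
      [pred p | tagged p \in porbits (sg (tag p))]].
Proof.
apply/setP => Q; apply/imsetP/imsetP => [[j _ ->]|[[O Q'] hQ ->]].
  have [[O [a u]] <-] := frames_surj iH cn j.
  exists (Tagged (fun O => {set 'I_(nu O)}) (porbit (sg O) u)); first exact: imset_f.
  exact: porbit_frames.
case/imsetP: (hQ : Q' \in porbits (sg O)) => u _ ->.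
by exists (H (pt (ord0 : 'I_(len O).+1) u)); rewrite ?porbit_frames.
Qed.

Lemma prod_porbits_frames (R : Type) (idx : R) (op : Monoid.com_law idx) (F : {set 'I_n} -> R) :
  \big[op/idx]_(Q in porbits s) F Q =
  \big[op/idx]_(O : cycleT s') \big[op/idx]_(Q in porbits (sg O)) F (cyc Q).
Proof.
rewrite porbits_frames big_imset /=.
  by rewrite (sig_big_dep xpredT (fun O (Q : {set 'I_(nu O)}) => Q \in porbits (sg O))
    (fun O Q => F (cyc Q))).
move=> [O Q] [O' Q'] /= hQ hQ'; apply: cyc_inj.
by case/andP: (card_porbit_mem hQ); rewrite card_gt0.
Qed.

Variables (c d : {ffun 'I_n -> mu r}) (c' : {ffun 'I_k -> mu r}).
Hypothesis cE : forall j, c j + d (s j) = d j + c' (t j).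

(** The terms in [d] cancel because [cyc Q] is stable under [s]; what remains is [c'] summed [#|Q|]
    times around [O]. *)
Lemma sum_cyc O (Q : {set 'I_(nu O)}) : Q \in porbits (sg O) ->
  \sum_(j in cyc Q) c j = (\sum_(i in val O) c' i) *+ #|Q|.
Proof.
move=> hQ; have hc : cyc Q \in porbits s.
  by rewrite porbits_frames; apply/imsetP; exists (Tagged (fun O => {set 'I_(nu O)}) Q).
have -> : \sum_(j in cyc Q) c j = \sum_(j in cyc Q) c' (t j).
  apply: (addIr (\sum_(j in cyc Q) d (s j))); rewrite -big_split /=.
  under eq_bigr do rewrite cE.
  rewrite big_split addrC /=; congr (_ + _).
  rewrite (reindex_inj (@perm_inj _ s)) /=; apply: eq_bigl => j.
  exact: porbit_stable.
rewrite big_imset /=; last by move=> [a u] [a' u'] _ _ /= /pt_inj [-> ->].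
rewrite (eq_bigl (fun z : 'I_(len O).+1 * 'I_(nu O) => true && (z.2 \in Q))); last first.
  by move=> z; rewrite !inE.
rewrite -(pair_big xpredT (mem Q) (fun a u => c' (t (H (pt a u))))) /=.
transitivity (\sum_(a < (len O).+1) c' (cyc_iter O a) *+ #|Q|).
  apply: eq_bigr => a _; rewrite -sumr_const; apply: eq_bigr => u _.
  by rewrite (frames_proj fr).
rewrite sumrMnl val_cyc_iter big_imset //= => a a' _ _.
by move=> /(cyc_iter_inj (ltn_ord a) (ltn_ord a')) [_ /val_inj].
Qed.

(** The rule p_e(z) o p_j = p_{ej}(j z) cycle by cycle: lengths come from [card_cyc], types from
    [sum_cyc]. *)
Lemma wev_frames (S : comNzRingType) (x : nat -> mu r -> S) :
  wev x c s = \prod_(O : cycleT s')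
    wev (dilx x (len O).+1 (\sum_(i in val O) c' i)) ([ffun=> 0] : {ffun _ -> mu 1}) (sg O).
Proof.
rewrite /wev prod_porbits_frames; apply: eq_bigr => O _; apply: eq_bigr => Q hQ.
by rewrite card_cyc sum_cyc // /dilx (@prednK #|Q|) //; case/andP: (card_porbit_mem hQ).
Qed.
End WeightOfFrames.

(** The factors away from [ord_max] force [u] to be constant along each cycle. *)
Lemma sum_cyclic_trace (R : comNzRingType) (I : finType) (len : I -> nat) (B : I -> finType)
    (M : forall i, B i -> B i -> R) :
  let J := {i : I & 'I_(len i).+1} in
  let p (j : J) : J := Tagged (fun i => 'I_(len i).+1) (ordS (tagged j)) in
  \sum_(u : {dffun forall j : J, B (tag j)})
     \prod_j (if tagged j == ord_max then M (tag j) (u j) (u (p j)) else (u j == u (p j))%:R) =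
  \prod_i \sum_b M i b b.
Proof.
move=> J p.
pose K (v : {dffun forall i, B i}) : {dffun forall j : J, B (tag j)} := [ffun j => v (tag j)].
pose K' (u : {dffun forall j : J, B (tag j)}) : {dffun forall i, B i} :=
  [ffun i => u (Tagged (fun i => 'I_(len i).+1) (ord0 : 'I_(len i).+1))].
have K'K v : K' (K v) = v by apply/ffunP => i; rewrite !ffunE.
rewrite (bigID (fun u => K (K' u) == u)) /= [X in _ + X]big1 ?addr0 => [|u ne]; last first.
  (* A family that is not constant along some cycle has a jump at a position other than [ord_max],
     where its factor is 0. *)
  have [j hj] : exists j : J, (tagged j != ord_max) && (u j != u (p j)).
    apply/existsP; apply: contraNT ne => /existsPn h.
    have E : forall i a (ha : (a < (len i).+1)%N),
        u (Tagged (fun i => 'I_(len i).+1) (ord0 : 'I_(len i).+1)) =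
        u (Tagged (fun i => 'I_(len i).+1) (Ordinal ha)).
      move=> i; pose uu (a : 'I_(len i).+1) : B i := u (Tagged (fun i => 'I_(len i).+1) a).
      elim=> [|a IH] ha; first by apply: (congr1 uu); apply/val_inj.
      have ha' := ltnW ha; rewrite (IH ha').
      have := h (Tagged (fun i => 'I_(len i).+1) (Ordinal ha')); rewrite negb_and !negbK /=.
      case/orP => [/eqP /(congr1 val) /= e|/eqP ->]; first by exfalso; move: (ha); rewrite e ltnn.
      by apply: (congr1 uu); apply/val_inj; rewrite /= modn_small.
    by apply/eqP/ffunP => -[i [a ha]]; rewrite ffunE /= ffunE; exact: E.
  by case/andP: hj => h1 h2; rewrite (bigD1 j) //= (negPf h1) (negPf h2) mul0r.
rewrite (reindex_onto K K') => [|u /eqP //].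
rewrite (eq_bigl xpredT) => [|v]; last by rewrite !K'K !eqxx.
rewrite -sum_dffun_prod; apply: eq_bigr => v _.
pose F i (a : 'I_(len i).+1) : R := if a == ord_max then M i (v i) (v i) else 1.
transitivity (\prod_(j : J) F (tag j) (tagged j)).
  by apply: eq_bigr => j _; rewrite /F !ffunE eqxx.
rewrite -(sig_big_dep xpredT (fun i (a : 'I_(len i).+1) => true) F) /=; apply: eq_bigr => i _.
rewrite (bigD1 ord_max) //= /F eqxx big1 ?mulr1 // => a /negPf -> //.
Qed.

(** * The trace of V on a labelled partition *)

Lemma triv_free (T : finType) : is_free_act (@triv T).
Proof. by split => // g x _; exact: ord1. Qed.

Lemma nact1 n (g : mu 1) (x : mu 1 * 'I_n) : nact g x = x.
Proof. by rewrite (ord1 g) nact0. Qed.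

Section Orbits.
Variables (r n k : nat).
Variables (c d : {ffun 'I_n -> mu r}) (s : 'S_n) (t : {ffun 'I_n -> 'I_k}).
Variables (c' : {ffun 'I_k -> mu r}) (s' : 'S_k).
Hypotheses (st : surjb t) (cov : covers c s d t c' s').
Notation A := (@nact r n).
Notation P := (fibs d t).
Notation w := (wfun c s).
Notation X := (mu r * 'I_n)%type.

Definition orb (i : 'I_k) : {set {set X}} := [set fib d t (z, i) | z : mu r].

Lemma orb_fib z i : [set actset A g (fib d t (z, i)) | g : mu r] = orb i.
Proof.
apply/setP => J; apply/imsetP/imsetP => -[g _ ->].
  by exists (g + z); rewrite ?actset_fib.
by exists (g - z); rewrite ?actset_fib /nact /= ?subrK.
Qed.

Lemma orb_in i : orb i \in orbs A P.
Proof. by apply/imsetP; exists (fib d t (0, i)); rewrite ?orb_fib //; exact: imset_f. Qed.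

Lemma orbsP Om : Om \in orbs A P -> exists i, Om = orb i.
Proof. by case/imsetP => _ /imsetP[[z i] _ ->] ->; exists i; rewrite orb_fib. Qed.

Lemma orb_inj : injective orb.
Proof.
move=> i j e; have : fib d t (0, i) \in orb j by rewrite -e; exact: imset_f.
by case/imsetP => z _ /(fib_inj st) [].
Qed.

Lemma rep_orb i : exists z, rep (orb i) = fib d t (z, i).
Proof.
rewrite /rep; case: pickP => [J /imsetP[z _ ->]|]; first by exists z.
by move/(_ (fib d t (0, i)))/negbT/negP; case; exact: imset_f.
Qed.

Lemma fimg_orb i : fimg w (orb i) = orb (s' i).
Proof.
apply/setP => J; apply/imsetP/imsetP => [[_ /imsetP[z _ ->] ->]|[z _ ->]].
  by exists (z + c' i) => //; rewrite (fimg_fib _ cov).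
exists (fib d t (z - c' i, i)); first exact: imset_f.
by rewrite (fimg_fib _ cov) /wfun /= subrK.
Qed.

Lemma fimg_orbs Om : Om \in orbs A P -> fimg w Om \in orbs A P.
Proof. by case/orbsP => i ->; rewrite fimg_orb orb_in. Qed.

(** The group element [b] of [Vpart]; by [shiftP] the search succeeds on orbits of blocks. *)
Definition shift (Om Om2 : {set {set X}}) : mu r :=
  odflt 0 [pick g : mu r | actset A g (w @: rep Om) == rep Om2].

Lemma shiftP Om : Om \in orbs A P ->
  actset A (shift Om (fimg w Om)) (w @: rep Om) = rep (fimg w Om).
Proof.
case/orbsP => i ->; rewrite fimg_orb /shift; case: pickP => [g /eqP //|h].
have [z ez] := rep_orb i; have [z' ez'] := rep_orb (s' i).
have := h (z' - (z + c' i)).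
by rewrite ez ez' (fimg_fib _ cov) actset_fib /wfun /nact /= subrK eqxx.
Qed.

Definition orb_succ (Om : OrbT A P) : OrbT A P := Sub (fimg w (val Om)) (fimg_orbs (valP Om)).

Lemma orb_map_subproof (Om : OrbT A P) (x : repT (val Om)) :
  A (shift (val Om) (val (orb_succ Om))) (w (val x)) \in rep (val (orb_succ Om)).
Proof.
have : A (shift (val Om) (val (orb_succ Om))) (w (val x)) \in
    actset A (shift (val Om) (fimg w (val Om))) (w @: rep (val Om)).
  by apply/imset_f/imset_f/valP.
by rewrite shiftP // (valP Om).
Qed.

Definition orb_map (Om : OrbT A P) (x : repT (val Om)) : repT (val (orb_succ Om)) :=
  exist (fun y => y \in rep (val (orb_succ Om))) _ (orb_map_subproof x).

Definition orbT_of (i : 'I_k) : OrbT A P := Sub (orb i) (orb_in i).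

Lemma orb_succ_of i : orb_succ (orbT_of i) = orbT_of (s' i).
Proof. by apply/val_inj; rewrite /= fimg_orb. Qed.

Lemma OrbTP (Om : OrbT A P) : exists i, Om = orbT_of i.
Proof. by have [i e] := orbsP (valP Om); exists i; apply/val_inj. Qed.

Lemma orb_map_bij (Om : OrbT A P) : bijective (@orb_map Om).
Proof.
apply: inj_surj_bij => [x y /(congr1 val) /= /(can_inj (nactK _)) /wfun_inj /val_inj //|y].
have : val y \in actset A (shift (val Om) (fimg w (val Om))) (w @: rep (val Om)).
  by rewrite shiftP ?(valP Om) // (valP y).
case/imsetP => _ /imsetP[x xr ->] ey.
by exists (Sub x xr); apply/val_inj; rewrite /= ey.
Qed.

(** Neither zero default of [Vpart] is reached: [w] maps orbits of blocks to such orbits, and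
    surjectivity of [t] makes the representatives nonempty. *)
Lemma VpartE (C : numClosedFieldType) (V : Bmod C 1)
    (v v2 : {dffun forall O : OrbT A P, @bas C 1 V _ (@triv (repT (val O)))}) Om :
  Vpart w v v2 Om = @mat C 1 V _ _ _ _ (@orb_map Om) (v Om) (v2 (orb_succ Om)).
Proof.
rewrite /Vpart (insubT (fun O => O \in orbs A P) (fimg_orbs (valP Om))) /=.
case: pickP => [y0 _|h].
  congr (mat _ _ _); apply: functional_extensionality => x.
  apply/val_inj; rewrite val_insubd.
  by rewrite (orb_map_subproof x).
have [i e] := OrbTP Om; subst Om.
have [z ez] := rep_orb i; have [x ex] := phi_surj d st (z, i).
have xr : x \in rep (val (orbT_of i)) by rewrite /= ez inE ex.
by have := h (orb_map (Sub x xr)).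
Qed.

(** A block meets every mu_r-orbit at most once. *)
Lemma fib_eq y (x1 x2 : X) : x1 \in fib d t y -> x2 \in fib d t y -> x1.2 = x2.2 -> x1 = x2.
Proof.
case: x1 x2 => [z1 j1] [z2 j2]; rewrite !inE /= => /eqP e1 /eqP e2 e; subst j2.
have /eqP := etrans e1 (esym e2).
by rewrite /phi xpair_eqE /= => /andP[/eqP /addIr -> _].
Qed.

Section Frames.
Variables (C : numClosedFieldType) (V : Bmod C 1) (nu : cycleT s' -> nat).
Variables (sg : {dffun forall O, 'S_(nu O)}) (H : {ffun model nu -> 'I_n}).
Hypotheses (fr : frames t s sg H) (iH : injectiveb H) (cn : #|{: model nu}| = n).

(** By [block_orb_bij] these pairs index the orbits of blocks, that is, the tensor factors, which
    [w] permutes as [block_next]. *)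
Definition blockT := {O : cycleT s' & 'I_(len O).+1}.
Definition block_next (j : blockT) : blockT := Tagged (fun O => 'I_(len O).+1) (ordS (tagged j)).
Definition block_proj (j : blockT) : 'I_k := cyc_iter (tag j) (tagged j).
(** In frame coordinates [w] is the identity from one fibre to the next, and [sg] when the cycle
    closes. *)
Definition block_map (j : blockT) : mu 1 * 'I_(nu (tag j)) -> mu 1 * 'I_(nu (tag (block_next j))) :=
  wfun [ffun=> 0] (if tagged j == ord_max then sg (tag j) else 1%g).
Definition block_orb (j : blockT) : OrbT A P := orbT_of (block_proj j).

Lemma block_next_bij : bijective block_next.
Proof.
apply: inj_surj_bij => [[O a] [O' a'] e|[O a]].
  have eO : O = O' := congr1 tag e; subst O'.
  by move/eqP: e; rewrite eq_Tagged => /eqP /= /(bij_inj (ordS_bij _)) ->.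
have [a' _ K] := ordS_bij (len O).+1.
by exists (Tagged (fun O => 'I_(len O).+1) (a' a)); rewrite /block_next /= K.
Qed.

Lemma block_proj_next j : block_proj (block_next j) = s' (block_proj j).
Proof.
case: j => O a; rewrite /block_proj /=; have := ltn_ord a.
rewrite ltnS leq_eqVlt => /orP[/eqP e|h]; last by rewrite modn_small.
by rewrite e modnn /= -[LHS](cyc_iter_wrap O) /cyc_iter.
Qed.

Lemma block_orb_bij : bijective block_orb.
Proof.
apply: inj_surj_bij => [[O a] [O' a'] /(congr1 val) /orb_inj|Om].
  move=> /(cyc_iter_inj (ltn_ord a) (ltn_ord a')) [eO]; subst O'.
  by move=> /val_inj ->.
have [i ->] := OrbTP Om; have [O [a ha e]] := cyc_iter_surj s' i.
by exists (Tagged (fun O => 'I_(len O).+1) (Ordinal ha)); rewrite /block_orb /block_proj /= e.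
Qed.

Lemma orb_succ_block j : block_orb (block_next j) = orb_succ (block_orb j).
Proof. by rewrite orb_succ_of /block_orb block_proj_next. Qed.

Definition repz (i : 'I_k) : mu r := odflt 0 [pick z | rep (orb i) == fib d t (z, i)].
Lemma repzE i : rep (orb i) = fib d t (repz i, i).
Proof.
rewrite /repz; case: pickP => [z /eqP //|h].
by have [z e] := rep_orb i; have := h z; rewrite e eqxx.
Qed.

(** The point with label [l] in the representative block; its group component is forced by [phi]. *)
Definition beta0 (j : blockT) (u : 'I_(nu (tag j))) : X :=
  let l := H (pt (tagged j) u) in (repz (block_proj j) - d l, l).

Lemma beta_subproof j (x : mu 1 * 'I_(nu (tag j))) : beta0 x.2 \in rep (val (block_orb j)).
Proof. by rewrite /= repzE inE /phi /= subrK (frames_proj fr). Qed.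

Definition beta j (x : mu 1 * 'I_(nu (tag j))) : repT (val (block_orb j)) :=
  exist (fun y => y \in rep (val (block_orb j))) _ (beta_subproof x).

Lemma beta_bij j : bijective (@beta j).
Proof.
apply: inj_surj_bij => [[z u] [z' u'] /(congr1 val) /(congr1 snd) /=|y].
  by move=> /(pt_inj iH) [_ ->]; rewrite (ord1 z) (ord1 z').
have yr : val y \in fib d t (repz (block_proj j), block_proj j) by rewrite -repzE; exact: (valP y).
have tl : t (val y).2 = block_proj j by move: yr; rewrite inE /phi xpair_eqE => /andP[_ /eqP].
have [[O' [a' u]] e] := frames_surj iH cn (val y).2.
have : cyc_iter O' a' = cyc_iter (tag j) (tagged j)
  by rewrite -/(block_proj j) -tl -e (frames_proj fr).
case/(cyc_iter_inj (ltn_ord a') (ltn_ord _)) => eO; case: j y yr tl e eO => O a y yr tl e /= eO.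
subst O' => /val_inj ea; subst a'.
exists (0, u); apply/val_inj; apply: (fib_eq _ yr); last by rewrite /= -e.
by rewrite -repzE; exact: (@beta_subproof (Tagged (fun O => 'I_(len O).+1) a) (0, u)).
Qed.

Lemma val_ecast_rep (Om Om' : OrbT A P) (e : Om = Om') (x : repT (val Om)) :
  val (ecast Om (repT (val Om)) e x) = val x.
Proof. by case: _ / e. Qed.

(** Both sides lie in one block, so by [fib_eq] only their labels matter, and these agree by
    [frames_step]. *)
Lemma beta_comm j x :
  orb_map (beta x) = ecast Om (repT (val Om)) (orb_succ_block j) (beta (block_map x)).
Proof.
apply/val_inj; rewrite val_ecast_rep.
pose i := block_proj (block_next j).
have h2 : val (beta (block_map x)) \in fib d t (repz i, i) by rewrite -repzE; exact: beta_subproof.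
have h1 : val (orb_map (beta x)) \in fib d t (repz i, i).
  rewrite -repzE -[orb i]/(val (block_orb (block_next j))) orb_succ_block; exact: orb_map_subproof.
apply: (fib_eq h1 h2); rewrite /= (frames_step fr); congr (H _).
by rewrite /step /=; case: ifP => // _; rewrite perm1.
Qed.

(** After the change of basis [beta], each cycle permutes its factors by identity matrices except
    one, that of [sg O]; [sum_cyclic_trace] then applies. *)
Lemma trace_Vpart :
  \sum_(v : {dffun forall O : OrbT A P, @bas C 1 V _ (@triv (repT (val O)))})
    \prod_(O : OrbT A P) Vpart w v v O =
  \prod_O \sum_b @mat C 1 V _ _ (@nact 1 (nu O)) (@nact 1 (nu O)) (wfun [ffun=> 0] (sg O)) b b.
Proof.
transitivity (\sum_(v : {dffun forall O : OrbT A P, @bas C 1 V _ (@triv (repT (val O)))})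
    \prod_(O : OrbT A P) @mat C 1 V _ _ _ _ (@orb_map O) (v O) (v (orb_succ O))).
  by apply: eq_bigr => v _; apply: eq_bigr => Om _; exact: VpartE.
rewrite (@mat_prod_trace_conj C 1 V (OrbT A P) blockT
  (fun Om => repT (val Om)) (fun Om => @triv (repT (val Om)))
  (fun j => (mu 1 * 'I_(nu (tag j)))%type) (fun j => @nact 1 (nu (tag j)))
  orb_succ orb_map block_next block_map block_orb beta orb_succ_block) //; first last.
- exact: beta_comm.
- exact: block_orb_bij.
- exact: block_next_bij.
- by move=> j; split; [exact: beta_bij | move=> g x; rewrite nact1].
- by move=> j; exact: wfun_mor.
- by move=> Om; split; [exact: orb_map_bij |].
- by move=> j; exact: nact_free.
- by move=> Om; exact: triv_free.
rewrite -(@sum_cyclic_trace C (cycleT s') (@len k s') (fun O => @bas C 1 V _ (@nact 1 (nu O)))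
  (fun O => @mat C 1 V _ _ (@nact 1 (nu O)) (@nact 1 (nu O)) (wfun [ffun=> 0] (sg O)))).
apply: eq_bigr => u _; apply: eq_bigr => j _; rewrite /block_map; case: ifP => // _.
rewrite (_ : wfun _ 1%g = fun x => x).
  by rewrite mat_id //; exact: nact_free.
apply: functional_extensionality => -[z i].
by rewrite /wfun /= perm1 (ord1 z) ffunE addr0.
Qed.
End Frames.
End Orbits.

(** * Comparison of the two sides *)

Lemma is_free_act_transfer r (T T' : finType) (a : mu r -> T -> T) (a' : mu r -> T' -> T')
    (h : T -> T') :
  bijective h -> (forall g x, h (a g x) = a' g (h x)) -> is_free_act a -> is_free_act a'.
Proof.
move=> [h' hK h'K] he [a0 aD af].
have E g y : a' g y = h (a g (h' y)) by rewrite he h'K.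
split=> [y|g g' y|g y]; rewrite !E; first by rewrite a0 h'K.
  by rewrite hK aD.
by move=> e; apply: (af g (h' y)); rewrite -{2}e hK.
Qed.

(** * The trace on the composite, as a sum over labellings *)

Section Trace.
Variables (C : numClosedFieldType) (r n : nat) (U : Bmod C r) (V : Bmod C 1).
Notation A := (@nact r n).
Notation X := (mu r * 'I_n)%type.

Definition Utrace (f : X -> X) (P : {set {set X}}) : C :=
  match P =P fimg f P with
  | ReflectT e => \sum_b @mat C r U _ _ (@blkact r X A P) (@blkact r X A P) (blkmap e) b b
  | ReflectF _ => 0
  end.

Definition Vtrace (f : X -> X) (P : {set {set X}}) : C :=
  \sum_(v : {dffun forall O : OrbT A P, @bas C 1 V _ (@triv (repT (val O)))})
    \prod_(O : OrbT A P) Vpart f v v O.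

Lemma comp_trace f :
  \sum_(x : compBasis U V A) compMat f x x =
  \sum_(P | adm A P) Utrace f P * Vtrace f P.
Proof.
rewrite (reindex_omap (val : admT A -> _) insub) => [|P hP]; last by rewrite insubT.
rewrite (eq_bigl xpredT) => [|P]; last by rewrite (valP P) valK eqxx.
pose F (P : admT A) (y : (bas U (@blkact r X A (val P)) *
    {dffun forall O : OrbT A (val P), @bas C 1 V _ (@triv (repT (val O)))})%type) : C :=
  @compMat C r U V X X A A f (Tagged _ y) (Tagged _ y).
transitivity (\sum_(P : admT A) \sum_y F P y).
  rewrite (sig_big_dep xpredT (fun _ => xpredT) F) /=.
  by apply: eq_bigr => -[P y] _.
apply: eq_bigr => P _; rewrite /F /compMat /Utrace /=.
case: eqP => [e|_]; last by rewrite mul0r big1.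
rewrite /Vtrace big_distrlr /= pair_big /=.
by apply: eq_bigr.
Qed.

(** At most one [w'] is covered, and none if the partition is not preserved; the double sum writes
    this without a choice. *)
Lemma Utrace_fibs k (c d : {ffun 'I_n -> mu r}) (s : 'S_n) (t : {ffun 'I_n -> 'I_k}) :
  surjb t -> Utrace (wfun c s) (fibs d t) =
  \sum_(c' : {ffun 'I_k -> mu r}) \sum_(s' : 'S_k) (covers c s d t c' s')%:R *
    \sum_b @mat C r U _ _ (@nact r k) (@nact r k) (wfun c' s') b b.
Proof.
move=> st; rewrite /Utrace; case: eqP => [e|ne]; last first.
  rewrite big1 // => c' _; rewrite big1 // => s' _; case: (boolP (covers c s d t c' s')).
    by move=> /fimg_fibs.
  by rewrite mul0r.
have [c' [s' cov]] := fimg_covers st e.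
rewrite (bigD1 c') //= (bigD1 s') //= cov mul1r.
rewrite [X in _ + X + _]big1 ?addr0 => [|s2 ne]; last first.
  case: (boolP (covers c s d t c' s2)) => [h|_]; last by rewrite mul0r.
  by have [_ es] := covers_unique st cov h; rewrite es eqxx in ne.
rewrite [X in _ + X]big1 ?addr0 => [|c2 ne]; last first.
  rewrite big1 // => s2 _; case: (boolP (covers c s d t c2 s2)) => [h|_]; last by rewrite mul0r.
  by have [ec _] := covers_unique st cov h; rewrite ec eqxx in ne.
have fin y : fib d t y \in fibs d t by exact: imset_f.
(* Sending a point to its fibre identifies [[k]_r] with the set of blocks and turns [w'] into
   [blkmap]. *)
pose h (y : mu r * 'I_k) : blkT (fibs d t) :=
  exist (fun J => J \in fibs d t) (fib d t y) (fin y).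
have hb : bijective h.
  apply: inj_surj_bij => [y y' /(congr1 val) /(fib_inj st) //|[J hJ]].
  by have /imsetP[y _ ey] := hJ; exists y; apply/val_inj; rewrite /= ey.
have he g y : h (nact g y) = blkact A g (h y).
  by apply/val_inj; rewrite /blkact val_insubd /= actset_fib imset_f.
have mh : is_mor (@nact r k) (@blkact r X A (fibs d t)) h by [].
have hw y : h (wfun c' s' y) = blkmap e (h y).
  by apply/val_inj; rewrite /= (fimg_fib _ cov).
have bfree := is_free_act_transfer hb he (@nact_free r k).
case: (hb) => h' hK h'K.
symmetry; apply: (mat_trace_conj U _ bfree _ _ mh hw); first exact: nact_free.
  exact: wfun_mor.
split.
  apply: (@eq_bij _ _ (h \o (wfun c' s' \o h'))).
    by apply: bij_comp => //; apply: bij_comp; [case: (wfun_mor c' s') | exists h].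
  by move=> J /=; rewrite hw h'K.
move=> g J; rewrite -[J]h'K -he -!hw; case: (wfun_mor c' s') => _ ->.
by rewrite he.
Qed.

Lemma comp_trace_fibs (c : {ffun 'I_n -> mu r}) (s : 'S_n) :
  \sum_(x : compBasis U V A) compMat (wfun c s) x x =
  \sum_(k < n.+1) (r.-1.+1 ^ k * k`!)%N%:R^-1 *
    \sum_(c' : {ffun 'I_k -> mu r}) \sum_(s' : 'S_k)
    (\sum_b @mat C r U _ _ (@nact r k) (@nact r k) (wfun c' s') b b) *
    \sum_(d : {ffun 'I_n -> mu r}) \sum_(t : {ffun 'I_n -> 'I_k} | surjb t)
      (covers c s d t c' s')%:R * Vtrace (wfun c s) (fibs d t).
Proof.
rewrite comp_trace sum_adm; apply: eq_bigr => k _; congr (_ * _).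
under [RHS]eq_bigr do under eq_bigr do rewrite mulr_sumr.
under [RHS]eq_bigr do rewrite exchange_big.
rewrite [RHS]exchange_big; apply: eq_bigr => d _ /=.
under [RHS]eq_bigr do under eq_bigr do rewrite mulr_sumr.
under [RHS]eq_bigr do rewrite exchange_big.
rewrite [RHS]exchange_big; apply: eq_bigr => t st /=.
rewrite Utrace_fibs // mulr_suml; apply: eq_bigr => c' _.
rewrite mulr_suml; apply: eq_bigr => s' _.
by rewrite mulrA [_%:R * _]mulrC.
Qed.
End Trace.

(** * The plethysm, expanded over the cycles of [w'] *)

Section PlethysmSide.
Variables (C : numClosedFieldType) (r n : nat) (V : Bmod C 1).
Hypothesis hV0 : #|@bas C 1 V void (@triv void)| = 0%N.
Variables (S : comNzRingType) (io : {rmorphism C -> S}) (x : nat -> mu r -> S).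

(** The contribution of monodromy [sg] over a cycle of length [j + 1] and type [z] with fibres of
    size [l]. *)
Definition cycle_term j (z : mu r) l (sg : 'S_l) : S :=
  wev (dilx x j.+1 z) ([ffun=> 0] : {ffun 'I_l -> mu 1}) sg *
  io (\sum_b @mat C 1 V _ _ (@nact 1 l) (@nact 1 l) (wfun [ffun=> 0] sg) b b).
Definition cycle_coef j z l : S := io (l`!%:R^-1) * \sum_(sg : 'S_l) cycle_term j z sg.
(** p_{j+1}(z) o ch V, truncated to the degrees that matter in degree n. *)
Definition cycle_poly j z : {poly S} := \sum_(l < n.+1) (cycle_coef j z l)%:P * 'X^(j.+1 * l).

(** [V] vanishes on the empty set; the hypothesis on [void] is carried over by an isomorphism. *)
Lemma cycle_term0 j z sg : @cycle_term j z 0 sg = 0.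
Proof.
have c0 : #|@bas C 1 V _ (@nact 1 0)| = 0%N.
  have mh : is_mor (@triv void) (@nact 1 0) (of_void _).
    by split=> [|g []]; apply: inj_surj_bij => [[] | [g []]].
  by rewrite -(card_bas_iso V (@triv_free _) (@nact_free 1 0) mh).
by rewrite /cycle_term big1 ?rmorph0 ?mulr0 // => b _; have := card0_eq c0 b; rewrite inE.
Qed.

Lemma ev_ch_dilx j z l : ev io l (dilx x j.+1 z) (ch V) = cycle_coef j z l.
Proof.
rewrite /ch ev_chc exp1n mul1n /cycle_coef; congr (_ * _).
rewrite (big_pred1 [ffun=> 0]) // => c; rewrite /= eq_sym; apply/esym/eqP.
by apply/ffunP => i; rewrite [LHS]ord1 [RHS]ord1.
Qed.

Lemma coef_cycle_poly j z a : (a <= n)%N ->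
  (cycle_poly j z)`_a = if (j.+1 %| a)%N then cycle_coef j z (a %/ j.+1) else 0.
Proof.
move=> an; rewrite /cycle_poly coef_sum; case: ifP => [/dvdnP[l]|h].
  rewrite mulnC => ea; subst a.
  have ln : (l < n.+1)%N by rewrite ltnS (leq_trans _ an) // leq_pmull.
  rewrite (bigD1 (Ordinal ln)) //= coefCM coefXn eqxx mulr1 mulKn //.
  rewrite big1 ?addr0 // => i ne; rewrite coefCM coefXn eqn_pmul2l //.
  case: eqP => e; last by rewrite mulr0.
  by case/eqP: ne; apply/val_inj.
apply: big1 => i _; rewrite coefCM coefXn; case: eqP => e; last by rewrite mulr0.
by rewrite e dvdn_mulr in h.
Qed.

Lemma cycle_poly_represents j z : represents io n x (pvar j.+1 z (ch V)) (cycle_poly j z).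
Proof.
move=> a an; rewrite coef_cycle_poly // ev_pvar //; case: ifP => // _.
by rewrite ev_ch_dilx.
Qed.

(** Expanding the product over the cycles chooses a fibre size for each, and the power of ['X]
    records the total size of the cover. *)
Lemma coef_wev_cycle_poly k (c' : {ffun 'I_k -> mu r}) (s' : 'S_k) :
  (wev cycle_poly c' s')`_n =
  \sum_(nu : {ffun cycleT s' -> 'I_n.+1} | (\sum_O (len O).+1 * nu O)%N == n)
    \prod_O cycle_coef (len O) (\sum_(i in val O) c' i) (nu O).
Proof.
rewrite /wev (reindex_omap (val : cycleT s' -> _) insub) => [|O hO]; last by rewrite insubT.
rewrite (eq_bigl xpredT) => [|O]; last by rewrite (valP O) valK eqxx.
rewrite /cycle_poly bigA_distr_bigA /= coef_sum [RHS]big_mkcond; apply: eq_bigr => nu _.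
rewrite big_split /= -rmorph_prod /= coefCM.
rewrite prodrXr coefXn eq_sym.
by case: eqP => _; rewrite ?mulr1 ?mulr0.
Qed.

Lemma cycle_coef0 j z : cycle_coef j z 0 = 0.
Proof. by rewrite /cycle_coef big1 ?mulr0 // => sg _; exact: cycle_term0. Qed.

(** The sum over [c] leaves one term, the sum over [d] gives a power of the order of [mu r], and
    [sum_lifts] gives [n!] over the product of the [(nu O)!]. The normalisation cancels all but the
    latter, which normalise the coefficients of [ch V]. *)
Lemma sum_covers k (c' : {ffun 'I_k -> mu r}) (s' : 'S_k) :
  io ((r.-1.+1 ^ n * n`!)%N%:R^-1) *
  (\sum_(c : {ffun 'I_n -> mu r}) \sum_(s : 'S_n)
    \sum_(d : {ffun 'I_n -> mu r}) \sum_(t : {ffun 'I_n -> 'I_k} | surjb t)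
      (covers c s d t c' s')%:R * (wev x c s * io (Vtrace V (wfun c s) (fibs d t)))) =
  (wev cycle_poly c' s')`_n.
Proof.
(* The covering equation solved for [c]. *)
pose cc (d : {ffun 'I_n -> mu r}) (s : 'S_n) (t : {ffun 'I_n -> 'I_k}) : {ffun 'I_n -> mu r} :=
  [ffun j => d j + c' (t j) - d (s j)].
pose F d t s := wev x (cc d s t) s * io (Vtrace V (wfun (cc d s t) s) (fibs d t)).
have covE c s d t : covers c s d t c' s' = lifts s' t s && (c == cc d s t).
  apply/forallP/andP => [h|[/forallP h /eqP ->] j]; last first.
    by rewrite h ffunE subrK eqxx.
  split; first by apply/forallP => j; case/andP: (h j).
  by apply/eqP/ffunP => j; rewrite ffunE; case/andP: (h j) => _ /eqP <-; rewrite addrK.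
transitivity (io ((r.-1.+1 ^ n * n`!)%N%:R^-1) * \sum_(d : {ffun 'I_n -> mu r})
    \sum_(t : {ffun 'I_n -> 'I_k} | surjb t) \sum_(s | lifts s' t s) F d t s).
  congr (_ * _); rewrite exchange_big /=.
  under eq_bigr do rewrite exchange_big /=.
  rewrite exchange_big; apply: eq_bigr => d _ /=.
  under eq_bigr do rewrite exchange_big /=.
  rewrite exchange_big; apply: eq_bigr => t st /=.
  rewrite [RHS]big_mkcond; apply: eq_bigr => s _ /=.
  rewrite (bigD1 (cc d s t)) //= covE eqxx andbT big1 ?addr0 => [|c /negPf ne].
    by case: ifP; rewrite ?mul1r ?mul0r.
  by rewrite covE ne andbF mul0r.
pose G (nu : cycleT s' -> nat) (sg : {dffun forall O, 'S_(nu O)}) : S :=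
  \prod_O @cycle_term (len O) (\sum_(i in val O) c' i) (nu O) (sg O).
have FG d (nu : cycleT s' -> nat) t s sg (H : {ffun model nu -> 'I_n}) : #|{: model nu}| = n ->
     injectiveb H -> frames t s sg H -> (forall O, 0 < nu O)%N -> F d t s = G nu sg.
  move=> cn iH fr npos.
  have ov := frames_lifts fr iH cn.
  have cov : covers (cc d s t) s d t c' s' by rewrite covE eqxx andbT.
  have st : surjb t.
    apply/forallP => i; have [O [a ha <-]] := cyc_iter_surj s' i.
    apply/existsP; exists (H (pt (Ordinal ha) (Ordinal (npos O)))).
    by rewrite (frames_proj fr).
  have cE j : cc d s t j + d (s j) = d j + c' (t j) by rewrite ffunE subrK.
  rewrite /F (wev_frames fr iH cn cE) /Vtrace (trace_Vpart st cov V fr iH cn).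
  by rewrite rmorph_prod -big_split.
under eq_bigr do rewrite (sum_lifts io (FG _)).
(* The summand no longer involves [d]. *)
rewrite sumr_const card_ffun !card_ord coef_wev_cycle_poly.
rewrite -[X in _ * X = _]mulr_natl mulrA -(rmorph_nat io) -rmorphM mulr_sumr.
(* Terms with an empty fibre are 0 by [cycle_coef0], so the two ranges of [nu] give the same sum. *)
rewrite [RHS](bigID (fun nu : {ffun cycleT s' -> 'I_n.+1} => [forall O, (0 < nu O)%N])) /=.
rewrite [X in _ = _ + X]big1 ?addr0 => [|nu /andP[_ /forallPn[O]]]; last first.
  by rewrite -eqn0Ngt => /eqP e; rewrite (bigD1 O) //= e cycle_coef0 mul0r.
apply: eq_bigr => nu _; rewrite mulrA -rmorphM /G.
rewrite (sum_dffun_prod (fun O => @cycle_term (len O) (\sum_(i in val O) c' i) (nu O))).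
rewrite /cycle_coef big_split /=; congr (_ * _); rewrite -rmorph_prod; congr (io _).
rewrite mulrA natrM invfM -(mulrA _ _ (n`!%:R)) mulrACA !mulVf ?mul1r //.
  by rewrite pnatr_eq0 -lt0n fact_gt0.
by rewrite pnatr_eq0 expn_eq0.
Qed.

End PlethysmSide.

Theorem theorem4p9 (C : numClosedFieldType) (r : nat) (hr : (0 < r)%N)
    (U : Bmod C r) (V : Bmod C 1)
    (hV0 : #|@bas C 1 V void (@triv void)| = 0%N) :
  forall (n : nat) (m : mono r n), weight m = n ->
    @chc C r (@compBasis C r U V) (@compMat C r U V) n m
    = @pleth C r (@ch C r U) (@ch C 1 V) n m.
Proof.
move=> n; apply: ev_inj => S io x.
rewrite (ev_pleth _ (@cycle_poly_represents C r n V S io x)) ev_chc.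
have -> : (r ^ n * n`!)%N = (r.-1.+1 ^ n * n`!)%N by rewrite prednK.
(* The sums are exchanged to put [w'] outside and the [w] covering it inside, as in [sum_covers]. *)
transitivity (\sum_(k < n.+1) io ((r.-1.+1 ^ k * k`!)%N%:R^-1) *
  \sum_(c' : {ffun 'I_k -> mu r}) \sum_(s' : 'S_k)
    io (\sum_b @mat C r U _ _ (@nact r k) (@nact r k) (wfun c' s') b b) *
    (io ((r.-1.+1 ^ n * n`!)%N%:R^-1) *
  (\sum_(c : {ffun 'I_n -> mu r}) \sum_(s : 'S_n)
    \sum_(d : {ffun 'I_n -> mu r}) \sum_(t : {ffun 'I_n -> 'I_k} | surjb t)
      (covers c s d t c' s')%:R * (wev x c s * io (Vtrace V (wfun c s) (fibs d t)))))).
  under eq_bigr do under eq_bigr do rewrite comp_trace_fibs rmorph_sum mulr_sumr.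
  under eq_bigr do rewrite exchange_big /=.
  rewrite exchange_big mulr_sumr; apply: eq_bigr => k _ /=.
  pose W c s (c' : {ffun 'I_k -> mu r}) (s' : 'S_k) : S :=
    \sum_(d : {ffun 'I_n -> mu r}) \sum_(t : {ffun 'I_n -> 'I_k} | surjb t)
      (covers c s d t c' s')%:R * (wev x c s * io (Vtrace V (wfun c s) (fibs d t))).
  pose u (c' : {ffun 'I_k -> mu r}) (s' : 'S_k) : S :=
    io (\sum_b @mat C r U _ _ (@nact r k) (@nact r k) (wfun c' s') b b).
  transitivity (io ((r.-1.+1 ^ n * n`!)%N%:R^-1) * \sum_(c : {ffun 'I_n -> mu r})
      \sum_(s : 'S_n) io ((r.-1.+1 ^ k * k`!)%N%:R^-1) *
        \sum_(c' : {ffun 'I_k -> mu r}) \sum_(s' : 'S_k) u c' s' * W c s c' s').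
    congr (_ * _); apply: eq_bigr => c _; apply: eq_bigr => s _.
    rewrite rmorphM mulrCA; congr (_ * _).
    rewrite rmorph_sum mulr_sumr; apply: eq_bigr => c' _.
    rewrite rmorph_sum mulr_sumr; apply: eq_bigr => s' _.
    rewrite rmorphM mulrCA; congr (_ * _).
    rewrite rmorph_sum mulr_sumr; apply: eq_bigr => d _.
    rewrite rmorph_sum mulr_sumr; apply: eq_bigr => t _.
    by rewrite rmorphM rmorph_nat mulrCA.
  under [X in _ * X = _]eq_bigr do rewrite -mulr_sumr.
  rewrite -mulr_sumr mulrCA; congr (_ * _).
  under [RHS]eq_bigr do under eq_bigr do rewrite mulrCA.
  under [RHS]eq_bigr do rewrite -mulr_sumr.
  rewrite -mulr_sumr; congr (_ * _).
  under eq_bigr do rewrite exchange_big /=.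
  rewrite exchange_big; apply: eq_bigr => c' _ /=.
  under eq_bigr do rewrite exchange_big /=.
  rewrite exchange_big; apply: eq_bigr => s' _ /=.
  rewrite mulr_sumr; apply: eq_bigr => c _.
  by rewrite mulr_sumr.
(* For each [k] the sides now match term by term in [w']: the inner sum is the coefficient of degree
   [n] of p_{w'} at the polynomials [cycle_poly]. *)
apply: eq_bigr => k _; rewrite /ch ev_chc coefCM.
rewrite (_ : (r ^ k * k`!)%N = (r.-1.+1 ^ k * k`!)%N); last by rewrite prednK.
congr (_ * _).
rewrite coef_sum; apply: eq_bigr => c' _; rewrite coef_sum; apply: eq_bigr => s' _.
by rewrite sum_covers // coefMC mulrC.
Qed.
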